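(* Let $n\ge 1$ be an integer and put $\rho=(-n-\tfrac12,0)$. For all $\mu,\nu\in\Lambda_n^*$, let $c_\nu(\mu)$ denote the scalar by which the Capelli operator $D_\nu$ acts on $V_\mu$. Then $$c_\nu(\mu)=\frac{P_\nu^\rho\left(\mu_1-n-\tfrac12,\ \mu_2\right)}{(\nu_1-\nu_2)!\,\nu_2!\,\left(\nu_1-(n+\tfrac12)\right)^{\underline{\nu_2}}}.$$ In particular, $c_\nu(\mu)=ab$, where $$a=\frac{\mu_2^{\underline{\nu_2}}\left(\mu_1-(n+\tfrac12)\right)^{\underline{\nu_2}}}{\nu_2!\,\left(\nu_1-(n+\tfrac12)\right)^{\underline{\nu_2}}\,(n+\tfrac12)^{\underline{\nu_1-\nu_2}}}$$ and $$b=\sum_{i=0}^{\nu_1-\nu_2}\binom{n+\frac12}{\nu_1-\nu_2-i}\binom{n+\frac12}{i}(\mu_1-\nu_2-i)^{\underline{\nu_1-\nu_2-i}}(\mu_2-\nu_2)^{\underline{i}}.$$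
   Context: Falling factorials: $x^{\underline{i}}=x(x-1)\cdots(x-i+1)$ (with $x^{\underline 0}=1$), and $\binom{x}{i}=x^{\underline i}/i!$. Superspace and Lie superalgebra. $V=\mathbb{C}^{1|2n}$ has basis $e_0$ (even), $e_1,\dots,e_{2n}$ (odd), and $B:V\times V\to\mathbb{C}$ is the non-degenerate even supersymmetric bilinear form whose Gram matrix in this basis is the $(1|n+n)$-block matrix $\begin{bmatrix}1&0&0\\0&0&-I_n\\0&I_n&0\end{bmatrix}$. $\mathfrak{osp}(1|2n)\subset\mathfrak{gl}(1|2n)$ is the Lie superalgebra spanned by the homogeneous $X$ with $B(Xu,v)+(-1)^{|X||u|}B(u,Xv)=0$ for all homogeneous $u,v\in V$. $\mathfrak{g}=\mathfrak{gosp}(1|2n)=\mathbb{C}Z\oplus\mathfrak{osp}(1|2n)$ with $Z$ central. Polynomials and differential operators. $\mathcal{P}(V)=\mathbb{C}[y]\otimes\Lambda(x_1,\dots,x_{2n})$ is the superalgebra generated by an even $y$ and odd $x_1,\dots,x_{2n}$, graded by total degree, with homogeneous components $\mathcal{P}^k(V)$. $\partial_y$ is the even derivation with $\partial_y(y)=1,\partial_y(x_j)=0$; $\partial_i$ is the odd derivation with $\partial_i(y)=0$, $\partial_i(x_j)=\delta_{i,j}$, $\partial_i(uv)=\partial_i(u)v+(-1)^{|u|}u\partial_i(v)$. $\mathcal{D}(V)$ is the algebra generated by $\partial_y,\partial_1,\dots,\partial_{2n}$, with homogeneous components $\mathcal{D}^k(V)$, and $\mathcal{PD}(V)\subset\mathrm{End}(\mathcal{P}(V))$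 is the algebra of polynomial-coefficient differential operators, generated by multiplications by $y,x_i$ and by $\partial_y,\partial_i$. $\mathfrak{gl}(1|2n)$, with matrix units $E_{i,j}$ ($1\le i,j\le 2n+1$, index $1$ corresponding to $e_0$ and index $i+1$ to $e_i$), acts on $\mathcal{P}(V)$ by $E_{1,1}\mapsto y\partial_y$, $E_{1,j+1}\mapsto y\partial_j$, $E_{j+1,1}\mapsto x_j\partial_y$, $E_{i+1,j+1}\mapsto x_i\partial_j$; $\mathfrak{osp}(1|2n)$ acts by restriction and $Z$ acts by the degree operator $E=y\partial_y+\sum_{i=1}^{2n}x_i\partial_i$. Harmonics. $R^2$ is multiplication by $y^2-2\sum_{i=1}^n x_{i+n}x_i$, and $\nabla^2=\partial_y^2-2\sum_{i=1}^n\partial_{i+n}\partial_i$. Both commute with $\mathfrak{osp}(1|2n)$. $\mathcal{H}_k=\ker(\nabla^2)\cap\mathcal{P}^k(V)$. Indexing. $\mathbb{P}=\{(\nu_1,\nu_2)\in\mathbb{Z}_{\ge0}^2:\nu_1\ge\nu_2\}$, $|\nu|=\nu_1+\nu_2$, $\mathbb{P}_{k,n}^*=\{\nu\in\mathbb{P}:|\nu|=k,\ \nu_2\ge\lfloor k/2\rfloor-n\}$, $\Lambda_n^*=\bigcup_{k\ge0}\mathbb{P}^*_{k,n}$. For $\nu\in\Lambda_n^*$ let $V_\nu=R^{2\nu_2}\mathcal{H}_{\nu_1-\nu_2}$. It is known that each $V_\nu$ is an irreducible $\mathfrak{g}$-module and that $\mathcal{P}^k(V)=\bigoplus_{\nu\in\mathbb{P}^*_{k,n}}V_\nu$,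 a multiplicity-free decomposition. Capelli operators. Let $\nu\in\Lambda_n^*$, $k=|\nu|$. Under the non-degenerate pairing $\mathcal{D}^k(V)\otimes\mathcal{P}^k(V)\to\mathbb{C}$ (apply the operator to the polynomial), $V_\nu^*$ is identified with the subspace of $\mathcal{D}^k(V)$ annihilating all $V_{\nu'}$ with $\nu'\in\mathbb{P}^*_{k,n}$, $\nu'\ne\nu$. If $\{v_i\}$ is a homogeneous basis of $V_\nu$ and $\{v_i^*\}\subset V_\nu^*$ is the dual basis ($v_i^*(v_j)=\delta_{i,j}$), then $D_\nu=\sum_i v_iv_i^*\in\mathcal{PD}(V)$; this is the $\mathfrak{g}$-invariant operator corresponding to the identity under $(V_\nu\otimes V_\nu^* )^{\mathfrak g}\cong\mathrm{Hom}_{\mathfrak g}(V_\nu,V_\nu)$. By Schur's Lemma, $D_\nu$ acts on each $V_\mu$, $\mu\in\Lambda_n^*$, by a scalar. Knop–Sahi polynomials. For $\nu\in\mathbb{P}$ and $\rho=(-n-\frac12,0)$, $P_\nu^\rho$ is the unique polynomial in two variables satisfying: (1) it is symmetric in the two variables; (2) $\deg P_\nu^\rho\le|\nu|$; (3) $P_\nu^\rho(\mu+\rho)=0$ for all $\mu\in\mathbb{P}$ with $|\mu|\le|\nu|$ and $\mu\ne\nu$; (4) $P_\nu^\rho(\nu+\rho)=(\nu_1-\nu_2)!\,\nu_2!\,(\nu_1-(n+\frac12))^{\underline{\nu_2}}$. *)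

(* Defs.v *)
From HB Require Import structures.
From mathcomp Require Import all_boot all_order all_algebra.
From mathcomp Require Import mpoly.

Set Implicit Arguments.
Unset Strict Implicit.
Unset Printing Implicit Defensive.

Import GRing.Theory.
Local Open Scope ring_scope.

Section FallingFactorial.
Variable F : fieldType.

Definition falling (x : F) (i : nat) : F := \prod_(j < i) (x - j%:R).
Definition gbinom (x : F) (i : nat) : F := falling x i / i`!%:R.

End FallingFactorial.

(* F[y] (x) Lambda(2n odd variables): [scoef u S] is the coefficient in F[y] of
   the monomial x_S, the product of the variables with index in S, taken in
   increasing order. Indices are 0-based: for i : 'I_n, [lshift n i] and
   [rshift n i] are the indices of x_{i+1} and x_{i+1+n} respectively. *)
Definition superpoly (F : fieldType) (n : nat) : Type :=
  {ffun {set 'I_(n + n)} -> {poly F}}.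

HB.instance Definition _ (F : fieldType) (n : nat) :=
  GRing.Lmodule.on (superpoly F n).

Section Superpoly.
Variables (F : fieldType) (n : nat).
Local Notation PV := (superpoly F n).
Implicit Types (u v : PV) (S A B : {set 'I_(n + n)}).

Definition spoly (f : {set 'I_(n + n)} -> {poly F}) : PV := finfun f.
Definition scoef u S : {poly F} := (u : {ffun _ -> {poly F}}) S.

(* x_A x_B = shuffle_sign A B *: x_(A :|: B) for disjoint A, B. *)
Definition shuffle_sign A B : F :=
  (-1) ^+ #|[set p : 'I_(n + n) * 'I_(n + n)
            | [&& p.1 \in A, p.2 \in B & (p.2 < p.1)%N]]|.

Definition smul u v : PV :=
  spoly (fun S => \sum_(A in powerset S)
           shuffle_sign A (S :\: A) *: (scoef u A * scoef v (S :\: A))).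

Definition sconst (c : F) : PV :=
  spoly (fun S => if S == set0 then c%:P else 0).
Definition svar_y : PV := spoly (fun S => if S == set0 then 'X else 0).
Definition svar_x (i : 'I_(n + n)) : PV := spoly (fun S => (S == [set i])%:R).

Definition d_y u : PV := spoly (fun S => (scoef u S)^`()).

(* The odd derivation d_i: if i \notin S, the coefficient of x_S in d_i u comes
   from x_({i} :|: S), where x_i is moved to the front past the x_j, j < i. *)
Definition d_x (i : 'I_(n + n)) u : PV :=
  spoly (fun S => if i \in S then 0
                  else (-1) ^+ #|[set j in S | (j < i)%N]| *: scoef u (i |: S)).

Definition in_degree (k : nat) u : Prop :=
  forall S i, (scoef u S)`_i != 0 -> (i + #|S| = k)%N.

Definition parity_homog u : Prop :=
  exists b : bool, forall S, scoef u S != 0 -> odd #|S| = b.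

(* None stands for d_y and [Some i] for d_i. *)
Definition d_gen (g : option 'I_(n + n)) : PV -> PV :=
  if g is Some i then d_x i else d_y.

Definition is_diffop (k : nat) (d : PV -> PV) : Prop :=
  exists c : k.-tuple (option 'I_(n + n)) -> F,
    forall u, d u = \sum_w c w *: foldr d_gen u w.

Definition R2 : PV :=
  smul svar_y svar_y
  - 2%:R *: \sum_(i < n) smul (svar_x (rshift n i)) (svar_x (lshift n i)).

Definition nabla2 u : PV :=
  d_y (d_y u) - 2%:R *: \sum_(i < n) d_x (rshift n i) (d_x (lshift n i) u).

Definition harmonic (k : nat) u : Prop := nabla2 u = 0 /\ in_degree k u.

Definition V_ (nu : nat * nat) u : Prop :=
  exists2 h, harmonic (nu.1 - nu.2) h & u = iter nu.2 (smul R2) h.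

Definition is_basis_of (W : PV -> Prop) (d : nat) (v : 'I_d -> PV) : Prop :=
  [/\ forall i, W (v i),
      forall c : 'I_d -> F, \sum_i c i *: v i = 0 -> forall i, c i = 0
    & forall u, W u -> exists c : 'I_d -> F, u = \sum_i c i *: v i].

Definition acts_by_scalar (D : PV -> PV) (W : PV -> Prop) (c : F) : Prop :=
  forall u, W u -> D u = c *: u.

End Superpoly.

Definition is_part (nu : nat * nat) : bool := (nu.2 <= nu.1)%N.

Definition weight (nu : nat * nat) : nat := (nu.1 + nu.2)%N.

(* [k./2 <= nu.2 + n] is nu_2 >= floor(k/2) - n without truncated subtraction. *)
Definition Pstar (k n : nat) (nu : nat * nat) : bool :=
  [&& is_part nu, weight nu == k & (k./2 <= nu.2 + n)%N].

Definition Lambda_star (n : nat) (nu : nat * nat) : Prop :=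
  exists k, Pstar k n nu.

Section Capelli.
Variables (F : fieldType) (n : nat).
Local Notation PV := (superpoly F n).

Definition V_dual (nu : nat * nat) (d : PV -> PV) : Prop :=
  is_diffop (weight nu) d /\
  forall nu', Pstar (weight nu) n nu' -> nu' <> nu ->
  forall u : PV, V_ nu' u -> d u = 0.

(* The pairing of D^k and P^k takes its values in P^0, the image of [sconst]. *)
Definition is_capelli (nu : nat * nat) (D : PV -> PV) : Prop :=
  exists (d : nat) (v : 'I_d -> PV) (vs : 'I_d -> PV -> PV),
    [/\ is_basis_of (V_ nu) v,
        forall i, parity_homog (v i),
        forall i, V_dual nu (vs i),
        forall i j, vs i (v j) = sconst n (i == j)%:R
      & forall u, D u = \sum_i smul (v i) (vs i u)].

End Capelli.

Section KnopSahi.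
Variables (F : fieldType) (n : nat).

Definition eval2 (P : {mpoly F[2]}) (a b : F) : F := P.@[tnth [tuple a; b]].

Definition rho1 : F := - n%:R - 2%:R^-1.

(* [msize P] is one more than the total degree of P <> 0. *)
Definition is_knop_sahi (nu : nat * nat) (P : {mpoly F[2]}) : Prop :=
  [/\ P \is symmetric,
      (msize P <= (weight nu).+1)%N,
      forall mu, is_part mu -> (weight mu <= weight nu)%N -> mu <> nu ->
        eval2 P (mu.1%:R + rho1) mu.2%:R = 0
    & eval2 P (nu.1%:R + rho1) nu.2%:R =
        (nu.1 - nu.2)`!%:R * nu.2`!%:R
        * falling (nu.1%:R - (n%:R + 2%:R^-1)) nu.2].

End KnopSahi.

(* Main.v *)
Require Import Defs.
From HB Require Import structures.
From mathcomp Require Import all_boot all_order all_algebra.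
From mathcomp Require Import fingroup perm.
From mathcomp Require Import ring zify.
From mathcomp Require Import reals.
From mathcomp Require Import complex mpoly.
From mathcomp Require boolp.

Set Implicit Arguments.
Unset Strict Implicit.
Unset Printing Implicit Defensive.

Import Order.TTheory GRing.Theory Num.Theory.
Local Open Scope ring_scope.

(** The proof replaces Schur's Lemma by a recursion that computes the scalars.

    For a linear map T of P(V) let [normal_op k T] be the operator
    sum_w T(w) d_w, where w runs over the monomials of degree k and the d_w
    form the dual basis of D^k.  It agrees with T on P^k
    ([normal_op_degree]) and depends only on the restriction of T to P^k
    ([eq_normal_op]); moreover every d in D^k equals [normal_op k d]
    ([diffop_normal_op]), so an element of D^k is determined by its pairing
    with P^k.  Consequently the Capelli operator D_nu is [normal_op k] of the
    projection of P^k onto V_nu, whatever basis of V_nu is used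
    ([capelli_is_capelli], [capelli_unique]).

    The commutator [nabla2, R2] = 4 (E + 1 - (n + 1/2)) ([commutator]) makes
    R2, nabla2 and the degree an sl2-triple.  As n + 1/2 is not an integer, the
    scalars by which nabla2 lowers R2^j h, with h harmonic and j > 0, never
    vanish; this gives P^k = sum_j R2^j H_(k-2j) ([decomposition]) and shows
    that the projection onto V_(m+j,j) is a multiple of
    R2^j (projection onto H_m) nabla2^j ([proj_shift]).  Multiplication by R2
    on the left and composition with nabla2 on the right pass through
    [normal_op], so D_(m+j,j) is that same multiple of R2^j D_(m,0) nabla2^j.
    Since the projections of P^m add up to the identity, and [normal_op m id]
    is binomial(E, m) ([normal_op_id]),

      sum_j D_(m-j,j) = binomial(E, m).

    The two relations determine all the scalars by induction on m
    ([normal_op_proj_scalar]).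

    The Knop-Sahi polynomials obey the same recursion.  The polynomial of
    (m+j,j) is, up to a constant, x(x-1)...(x-j+1) y(y-1)...(y-j+1) times that
    of (m,0) at (x-j, y-j).  The sum relation holds because the two sides
    differ by a symmetric polynomial of degree at most m that vanishes at
    every partition of size at most m, and such a polynomial is zero
    ([symmetric_vanish], [ks_binomial]).  The polynomial of (m,0) has two
    expressions, related by the Vandermonde identity: one is visibly symmetric
    in x and y, the other is the sum b of the theorem and visibly has the
    required zeros ([ks_fun_closed], [ks_fun_vanish]). *)

(** * The superalgebra of polynomials and its derivations *)

Section Generators.
Variables (F : fieldType) (n : nat).
Local Notation PV := (superpoly F n).
Local Notation gen := (option 'I_(n + n)).
Implicit Types (u v : PV) (S A B : {set 'I_(n + n)}) (g : gen) (i j : 'I_(n + n)).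

Lemma scoefE (f : {set 'I_(n + n)} -> {poly F}) S : scoef (spoly f) S = f S.
Proof. by rewrite /scoef /spoly ffunE. Qed.

Lemma superpolyP u v : (forall S, scoef u S = scoef v S) -> u = v.
Proof. by move=> uv; apply/ffunP. Qed.

Lemma scoefD u v S : scoef (u + v) S = scoef u S + scoef v S.
Proof. by rewrite /scoef !ffunE. Qed.

Lemma scoefZ c u S : scoef (c *: u) S = c *: scoef u S.
Proof. by rewrite /scoef !ffunE. Qed.

Lemma scoef0 S : scoef (0 : PV) S = 0.
Proof. by rewrite /scoef !ffunE. Qed.

Lemma scoef_sum I (r : seq I) (P : pred I) (f : I -> PV) S :
  scoef (\sum_(i <- r | P i) f i) S = \sum_(i <- r | P i) scoef (f i) S.
Proof.
by elim/big_rec2: _ => [|i x y _ <-]; rewrite ?scoef0 // scoefD.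
Qed.

Lemma smul_is_linear u : linear (smul u).
Proof.
move=> c v w; apply: superpolyP => S.
rewrite scoefD scoefZ !scoefE scaler_sumr -big_split /=; apply: eq_bigr => A _.
by rewrite scoefD scoefZ mulrDr scalerDr -scalerAr !scalerA mulrC.
Qed.

HB.instance Definition _ u :=
  GRing.isLinear.Build F PV PV _ (smul u) (smul_is_linear u).

Lemma smul_linearl u : linear (fun v => smul v u).
Proof.
move=> c v w; apply: superpolyP => S.
rewrite scoefD scoefZ !scoefE scaler_sumr -big_split /=; apply: eq_bigr => A _.
by rewrite scoefD scoefZ mulrDl scalerDr -scalerAl !scalerA mulrC.
Qed.

Lemma smulDl u v w : smul (u + v) w = smul u w + smul v w.
Proof. by rewrite -[u]scale1r smul_linearl !scale1r. Qed.

Lemma smul0l w : smul (0 : PV) w = 0.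
Proof.
apply: superpolyP => S; rewrite scoefE scoef0 big1 // => A _.
by rewrite scoef0 mul0r scaler0.
Qed.

Lemma smulZl c u w : smul (c *: u) w = c *: smul u w.
Proof. by rewrite -[c *: u]addr0 smul_linearl smul0l addr0. Qed.

Lemma smul_suml I (r : seq I) (P : pred I) (f : I -> PV) w :
  smul (\sum_(i <- r | P i) f i) w = \sum_(i <- r | P i) smul (f i) w.
Proof.
by elim/big_rec2: _ => [|i x y _ <-]; rewrite ?smul0l // smulDl.
Qed.

(** The sign of moving x_i to the front of x_S, past the x_j with j < i. *)
Definition jump_sign i S : F := (-1) ^+ #|[set j in S | (j < i)%N]|.

Lemma jump_signK i S (p : {poly F}) : jump_sign i S *: (jump_sign i S *: p) = p.
Proof. by rewrite scalerA -expr2 /jump_sign sqrr_sign scale1r. Qed.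

Lemma jump_signU i j S :
  j \notin S -> jump_sign i (j |: S) = (-1) ^+ (j < i)%N * jump_sign i S.
Proof.
move=> jS; rewrite /jump_sign -exprD; congr (_ ^+ _).
case: (ltnP j i) => ji /=.
  rewrite (cardsD1 j) !inE eqxx ji /=; congr (_ + _)%N; apply: eq_card => k.
  by rewrite !inE; case: eqP => // ->; rewrite (negPf jS).
apply: eq_card => k; rewrite !inE; case: eqP => // ->.
by rewrite (negPf jS) ltnNge ji.
Qed.

Lemma jump_signD i j S :
  j \in S -> jump_sign i (S :\ j) = (-1) ^+ (j < i)%N * jump_sign i S.
Proof.
move=> jS; rewrite -{2}(setD1K jS) jump_signU ?setD11 // mulrA -expr2 sqrr_sign.
by rewrite mul1r.
Qed.

Lemma shuffle_sign0 B : shuffle_sign F (set0 : {set 'I_(n + n)}) B = 1.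
Proof.
rewrite /shuffle_sign (_ : [set _ | _] = set0) ?cards0 //.
by apply/setP => p; rewrite !inE.
Qed.

Lemma shuffle_sign1 i B : shuffle_sign F [set i] B = jump_sign i B.
Proof.
rewrite /shuffle_sign /jump_sign; congr (_ ^+ _).
rewrite -(card_imset _ (can_inj (fun j => erefl : (fun p => p.2) (i, j) = j))) /=.
apply: eq_card => -[a b]; rewrite !inE /=; apply/idP/imsetP.
  by case/and3P=> /eqP -> bB ba; exists b; rewrite // !inE bB.
by case=> j; rewrite !inE => /andP[jB ji] [-> ->]; rewrite eqxx jB.
Qed.

Lemma shuffle_signU i A B :
  i \notin A ->
  shuffle_sign F (i |: A) B = jump_sign i B * shuffle_sign F A B.
Proof.
move=> iA; rewrite -shuffle_sign1 /shuffle_sign -exprD; congr (_ ^+ _).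
rewrite -cardsUI [X in _ = (_ + X)%N](_ : _ = 0%N) ?addn0.
  by apply: eq_card => p; rewrite !inE; case: (p.1 == i); case: (p.1 \in A);
     rewrite //= ?orbF ?orbb.
apply/eqP; rewrite cards_eq0; apply/eqP/setP=> p; rewrite !inE.
case: eqP => // ->; by rewrite (negPf iA) /= andbF.
Qed.

Lemma jump_sign_disjoint i A B :
  [disjoint A & B] -> jump_sign i (A :|: B) = jump_sign i A * jump_sign i B.
Proof.
move=> AB; rewrite /jump_sign -exprD; congr (_ ^+ _).
rewrite -cardsUI [X in _ = (_ + X)%N](_ : _ = 0%N) ?addn0.
  by apply: eq_card => p; rewrite !inE; case: (p \in A); case: (p \in B); rewrite //= ?orbb ?orbF.
apply/eqP; rewrite cards_eq0; apply/eqP/setP=> p; rewrite !inE.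
case: (boolP (p \in A)) => //= pA.
by rewrite (disjointFr AB pA) /= andbF.
Qed.

Lemma scoef_mul_y u S : scoef (smul (svar_y F n) u) S = 'X * scoef u S.
Proof.
rewrite scoefE (bigD1 set0) ?powersetE ?sub0set //= big1 => [|A /andP[_ A0]].
  by rewrite addr0 scoefE eqxx setD0 shuffle_sign0 scale1r.
by rewrite scoefE (negPf A0) mul0r scaler0.
Qed.

Lemma scoef_mul_x i u S :
  scoef (smul (svar_x F i) u) S
  = if i \in S then jump_sign i S *: scoef u (S :\ i) else 0.
Proof.
rewrite scoefE; case: ifP => iS.
  rewrite (bigD1 [set i]) ?powersetE ?sub1set //= big1 => [|A /andP[_ A0]].
    rewrite addr0 scoefE eqxx mul1r shuffle_sign1 jump_signD //.
    by rewrite ltnn mul1r.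
  by rewrite scoefE (negPf A0) mul0r scaler0.
rewrite big1 // => A; rewrite powersetE => AS; rewrite scoefE.
case: eqP => [Ai|_]; last by rewrite mul0r scaler0.
by move: AS; rewrite Ai sub1set iS.
Qed.

Lemma scoef_d_x i u S :
  scoef (d_x i u) S
  = if i \in S then 0 else jump_sign i S *: scoef u (i |: S).
Proof. by rewrite scoefE. Qed.

Lemma scoef_d_y u S : scoef (d_y u) S = (scoef u S)^`().
Proof. by rewrite scoefE. Qed.

Lemma d_gen_is_linear g : linear (d_gen g : PV -> PV).
Proof.
case: g => [i|] c u v; apply: superpolyP => S; rewrite scoefD scoefZ /=.
  rewrite !scoef_d_x scoefD scoefZ; case: ifP => _; first by rewrite scaler0 addr0.
  by rewrite scalerDr !scalerA mulrC.
by rewrite !scoef_d_y scoefD scoefZ derivD derivZ.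
Qed.

HB.instance Definition _ g :=
  GRing.isLinear.Build F PV PV _ (d_gen g) (d_gen_is_linear g).

Definition mul_gen g : PV -> PV :=
  smul (if g is Some i then svar_x F i else svar_y F n).

HB.instance Definition _ g := GRing.Linear.on (mul_gen g).

(** The sign rule for exchanging two generators: only two odd ones
    anticommute. *)
Definition swap_sign g h : F := if g && h then -1 else 1.

(** The super Weyl relations.  With [d_genC] and [mul_gen_smul] they are all that
    the later sections use of the product of the superalgebra. *)
Lemma d_mul_gen g h u :
  d_gen g (mul_gen h u)
  = (g == h)%:R *: u + swap_sign g h *: mul_gen h (d_gen g u).
Proof.
rewrite /swap_sign.
case: g h => [i|] [j|]; apply: superpolyP => S; rewrite scoefD !scoefZ /mul_gen /=.
- rewrite scoef_d_x scoef_mul_x.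
  case: (eqVneq i j) => [->|ij]; rewrite ?eqxx.
    rewrite scale1r setU11 scoef_mul_x scoef_d_x setD11.
    case: ifP => jS; last first.
      by rewrite scaler0 addr0 jump_signU ?jS // ltnn mul1r jump_signK setU1K // jS.
    by rewrite jump_signD // ltnn mul1r jump_signK setD1K // scaleN1r subrr.
  rewrite (_ : (Some i == Some j) = false) ?scale0r ?add0r; last first.
    by apply/negP => /eqP [] /eqP; rewrite (negPf ij).
  rewrite !inE eq_sym (negPf ij) /= scoef_mul_x scoef_d_x !inE (negPf ij) /=.
  case: (boolP (i \in S)) => iS; case: (boolP (j \in S)) => jS; rewrite ?scaler0 //.
  rewrite jump_signD // jump_signU // scaleN1r !scalerA.
  rewrite (_ : (i |: S) :\ j = i |: S :\ j); last first.
    apply/setP => k; rewrite !inE; case: (eqVneq k i) => // ->.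
    by rewrite ij.
  rewrite -scaleNr; congr (_ *: _).
  have [ji|ji|/val_inj eij] := ltngtP j i; rewrite ?expr0 ?expr1; [ring|ring|].
  by rewrite eij eqxx in ij.
- by rewrite scale0r scale1r add0r !(scoef_d_x, scoef_mul_y); case: ifP => _;
  rewrite ?mulr0 // scalerAr.
- rewrite scale0r scale1r add0r !(scoef_d_y, scoef_mul_x); case: ifP => _;
  by rewrite ?derivZ ?deriv0.
- by rewrite !(scoef_d_y, scoef_mul_y) !scale1r derivM derivX mul1r.
Qed.

Lemma d_genC g h u : d_gen g (d_gen h u) = swap_sign g h *: d_gen h (d_gen g u).
Proof.
rewrite /swap_sign.
case: g h => [i|] [j|]; apply: superpolyP => S; rewrite !scoefZ /=.
- rewrite !scoef_d_x !inE (eq_sym j i).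
  case: (boolP (i \in S)) => iS; rewrite ?orbT ?scaler0 ?if_same ?scaler0 //=.
  case: (eqVneq i j) => [->|ij]; rewrite ?if_same ?scaler0 ?if_same ?scaler0 //=.
  case: (boolP (j \in S)) => jS; rewrite ?scaler0 ?orbT ?scaler0 //=.
  rewrite !jump_signU // setUCA !scalerA; congr (_ *: _).
  have [ji|ji|/val_inj eij] := ltngtP j i; rewrite ?expr0 ?expr1; [ring|ring|].
  by rewrite eij eqxx in ij.
- by rewrite scale1r !(scoef_d_x, scoef_d_y); case: ifP; rewrite ?derivZ ?deriv0.
- by rewrite scale1r !(scoef_d_x, scoef_d_y); case: ifP; rewrite ?derivZ ?deriv0.
- by rewrite scale1r.
Qed.

(** Associativity is needed only with a generator as first factor, where it
    reduces to pulling the sign of x_i out of a shuffle sign. *)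
Lemma mul_gen_smul g u v : mul_gen g (smul u v) = smul (mul_gen g u) v.
Proof.
case: g => [i|]; apply: superpolyP => S; rewrite /mul_gen; last first.
  rewrite scoef_mul_y !scoefE mulr_sumr; apply: eq_bigr => A _.
  by rewrite scoef_mul_y -mulrA -scalerAr.
rewrite scoef_mul_x [RHS]scoefE.
under eq_bigr => A _ do rewrite scoef_mul_x.
case: (boolP (i \in S)) => iS; last first.
  rewrite big1 // => A; rewrite powersetE => /subsetP AS; case: ifP => [/AS|_].
    by rewrite (negPf iS).
  by rewrite mul0r scaler0.
rewrite [RHS](bigID (fun A => i \in A)) /= [X in _ = _ + X]big1 ?addr0; last first.
  by move=> A /andP[_ /negPf ->]; rewrite mul0r scaler0.
rewrite scoefE scaler_sumr.
(* On the right only subsets containing i contribute: index them by A = B minus i. *)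
rewrite [RHS](reindex_onto (fun A => i |: A) (fun A => A :\ i)) /=; last first.
  by move=> A /andP[_ iA]; rewrite setD1K.
rewrite [RHS](eq_bigl (fun A => A \in powerset (S :\ i))); last first.
  move=> A; rewrite !powersetE setU11 andbT subUset sub1set iS /= subsetD1.
  congr (_ && _); apply/eqP/idP => [<-|iA]; first by rewrite setD11.
  by rewrite setU1K.
apply: eq_bigr => A; rewrite powersetE subsetD1 => /andP[AS iA].
rewrite setU11 setU1K // setDDl.
set C := S :\: (i |: A).
have -> : shuffle_sign F (i |: A) C = jump_sign i C * shuffle_sign F A C.
  by rewrite shuffle_signU.
have dAC : [disjoint A & C].
  by rewrite -setI_eq0; apply/eqP/setP => k; rewrite !inE; case: (k \in A); rewrite //= ?orbT.
have SE : jump_sign i S = jump_sign i A * jump_sign i C.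
  rewrite -jump_sign_disjoint // -(setD1K iS) jump_signU ?setD11 // ltnn mul1r.
  congr (jump_sign _ _); apply/setP => k; rewrite !inE.
  case: (eqVneq k i) => [->|ki] /=; rewrite ?(negPf iA) //=.
  by case: (boolP (k \in A)) => /= [kA|//]; rewrite (subsetP AS).
rewrite jump_signU // ltnn mul1r.
rewrite SE -scalerAl !scalerA; congr (_ *: _); ring.
Qed.

Lemma smul1 u : smul (sconst n 1) u = u.
Proof.
apply: superpolyP => S.
rewrite scoefE (bigD1 set0) ?powersetE ?sub0set //= big1 => [|A /andP[_ A0]].
  by rewrite addr0 scoefE eqxx setD0 shuffle_sign0 scale1r mul1r.
by rewrite scoefE (negPf A0) mul0r scaler0.
Qed.

Lemma smulr1 u : smul u (sconst n 1) = u.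
Proof.
apply: superpolyP => S.
rewrite scoefE (bigD1 S) ?powersetE //= big1 => [|A /andP[]].
  rewrite addr0 scoefE setDv eqxx /shuffle_sign (_ : [set _ | _] = set0).
    by rewrite cards0 scale1r mulr1.
  by apply/setP => p; rewrite !inE andbF.
rewrite powersetE scoefE setD_eq0 eqEsubset => -> /= /negPf ->.
by rewrite mulr0 scaler0.
Qed.

Lemma sconstE c : sconst n c = c *: (sconst n 1 : PV).
Proof.
apply: superpolyP => S; rewrite scoefZ !scoefE; case: ifP; rewrite ?scaler0 //.
by rewrite -mul_polyC mulr1.
Qed.

Lemma in_degreeD k u v : in_degree k u -> in_degree k v -> in_degree k (u + v).
Proof.
move=> ku kv S a; rewrite scoefD coefD => nz.
have [/eqP u0|/ku //] := boolP ((scoef u S)`_a == 0).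
by apply: kv; rewrite u0 add0r in nz.
Qed.

Lemma in_degreeZ k c u : in_degree k u -> in_degree k (c *: u).
Proof.
move=> ku S a; rewrite scoefZ coefZ => nz; apply: ku.
by apply: contraNneq nz => ->; rewrite mulr0.
Qed.

Lemma in_degree0 k : in_degree k (0 : PV).
Proof. by move=> S a; rewrite scoef0 coef0 eqxx. Qed.

Lemma in_degree_sum k I (r : seq I) (P : pred I) (f : I -> PV) :
  (forall t, P t -> in_degree k (f t)) ->
  in_degree k (\sum_(i <- r | P i) f i).
Proof.
by move=> kf; elim/big_rec: _ => [|i x Pi]; [exact: in_degree0 | apply/in_degreeD/kf].
Qed.

Lemma in_degree_mul_gen g k u : in_degree k u -> in_degree k.+1 (mul_gen g u).
Proof.
move=> ku S a; case: g => [i|]; rewrite /mul_gen.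
  rewrite scoef_mul_x; case: ifP => iS; last by rewrite coef0 eqxx.
  rewrite coefZ => nz; rewrite -(ku (S :\ i) a).
    by rewrite (cardsD1 i S) iS addnCA.
  by apply: contraNneq nz => ->; rewrite mulr0.
rewrite scoef_mul_y mulrC coefMX; case: a => [|a] /=; first by rewrite eqxx.
by move=> /ku <-.
Qed.

Lemma in_degree_d_gen g k u : in_degree k u -> in_degree k.-1 (d_gen g u).
Proof.
move=> ku S a; case: g => [i|] /=.
  rewrite scoef_d_x; case: ifP => iS; first by rewrite coef0 eqxx.
  rewrite coefZ => nz; rewrite -(ku (i |: S) a).
    by rewrite cardsU1 iS addnCA.
  by apply: contraNneq nz => ->; rewrite mulr0.
rewrite scoef_d_y coef_deriv => nz; rewrite -(ku S a.+1) //.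
by apply: contraNneq nz => ->; rewrite mul0rn.
Qed.

Lemma in_degree_coef k u S a :
  in_degree k u -> (a + #|S| != k)%N -> (scoef u S)`_a = 0.
Proof. by move=> ku ak; apply/eqP; apply: contraNT ak => /ku ->. Qed.

Lemma d_gen_degree0 g u : in_degree 0 u -> d_gen g u = 0.
Proof.
move=> u0; apply: superpolyP => S; rewrite scoef0; case: g => [i|] /=.
  rewrite scoef_d_x; case: ifP => // iS; apply/polyP => a; rewrite coefZ coef0.
  by rewrite (in_degree_coef u0) ?mulr0 // cardsU1 iS addnCA.
rewrite scoef_d_y; apply/polyP => a; rewrite coef_deriv coef0.
by rewrite (in_degree_coef u0) ?mul0rn.
Qed.

Lemma in_degree0P u : in_degree 0 u -> exists c, u = sconst n c.
Proof.
move=> u0; exists (scoef u set0)`_0; apply: superpolyP => S; rewrite scoefE.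
apply/polyP => a; case: eqP => [->|/eqP S0]; rewrite ?coefC ?coef0.
  by case: a => //= a; rewrite (in_degree_coef u0).
by rewrite (in_degree_coef u0) ?if_same // addn_eq0 cards_eq0 (negPf S0) andbF.
Qed.

Lemma in_degree_sconst c : in_degree 0 (sconst n c : PV).
Proof.
move=> S a; rewrite scoefE; case: (eqVneq S set0) => [->|_]; rewrite ?coefC ?coef0 ?if_same ?eqxx //.
by rewrite cards0; case: (eqVneq a 0%N) => [->|_]; rewrite ?eqxx.
Qed.

Lemma sum_gen (U : zmodType) (f : gen -> U) :
  \sum_g f g = f None + \sum_i f (Some i).
Proof.
rewrite (bigD1 None) //=; congr (_ + _).
rewrite (reindex_omap Some id) => [|[i|]] //=.
by apply: eq_bigl => i; rewrite eqxx.
Qed.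

(** The field sum_g x_g d_g multiplies a monomial by its degree: X p' counts the
    power of y, and each i in S contributes x_S once, the two signs cancelling. *)
Lemma euler k u : in_degree k u -> \sum_g mul_gen g (d_gen g u) = k%:R *: u.
Proof.
move=> ku; apply: superpolyP => S; rewrite scoef_sum scoefZ.
rewrite sum_gen /= /mul_gen scoef_mul_y /= scoef_d_y.
rewrite (eq_bigr (fun i => if i \in S then scoef u S else 0)) => [|i _]; last first.
  rewrite scoef_mul_x; case: ifP => // iS.
  by rewrite scoef_d_x setD11 jump_signD // ltnn mul1r jump_signK setD1K.
rewrite -big_mkcond sumr_const /=; apply/polyP => a.
rewrite mulrC coefD coefMn coefMX coefZ mulr_natl.
have [/eqP u0|/ku <-] := boolP ((scoef u S)`_a == 0).
  rewrite u0 !mul0rn addr0; case: eqP => // a0.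
  by rewrite coef_deriv prednK ?u0 ?mul0rn // lt0n; apply/eqP.
by rewrite mulrnDr; case: eqP => [->|/eqP a0]; rewrite ?coef_deriv ?prednK ?lt0n ?mulr0n.
Qed.

End Generators.

(** * Normally ordered differential operators *)
Section NormalOperators.
Variables (F : numFieldType) (n : nat).
Local Notation PV := (superpoly F n).
Local Notation gen := (option 'I_(n + n)).
Local Notation one := (sconst n 1 : PV).
Implicit Types (u v : PV) (g : gen).

(** The operator sum_w T(w) d_w over the monomials w of degree k, where d_w is
    the dual basis of D^k.  Euler's formula, applied k times, gives this form,
    which never has to name or order the monomials. *)
Fixpoint normal_op (k : nat) (T : PV -> PV) (u : PV) : PV :=
  if k is k'.+1 then
    k%:R^-1 *: \sum_g normal_op k' (T \o mul_gen g) (d_gen g u)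
  else smul (T one) u.

Lemma normal_opS k (T : PV -> PV) u :
  normal_op k.+1 T u
  = k.+1%:R^-1 *: \sum_g normal_op k (T \o mul_gen g) (d_gen g u).
Proof. by []. Qed.

Lemma normal_op0 (T : PV -> PV) u : normal_op 0 T u = smul (T one) u.
Proof. by []. Qed.

Arguments normal_op : simpl never.

Lemma normal_op_is_linear k T : linear (normal_op k T).
Proof.
elim: k T => [|k IH] T c u v; first by rewrite !normal_op0 linearP.
rewrite !normal_opS.
rewrite scalerA mulrC -scalerA -scalerDr; congr (_ *: _).
rewrite scaler_sumr -big_split /=; apply: eq_bigr => g _.
by rewrite linearP IH.
Qed.

HB.instance Definition _ k T :=
  GRing.isLinear.Build F PV PV _ (normal_op k T) (normal_op_is_linear k T).

Lemma eq_normal_op k (T T' : PV -> PV) :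
  (forall u, in_degree k u -> T u = T' u) -> normal_op k T =1 normal_op k T'.
Proof.
elim: k T T' => [|k IH] T T' eqT u; rewrite ?normal_op0 ?normal_opS; first by rewrite eqT //; apply: in_degree_sconst.
congr (_ *: _); apply: eq_bigr => g _; apply: IH => v kv /=.
exact/eqT/in_degree_mul_gen.
Qed.

Lemma normal_op_sum k I (r : seq I) (P : pred I) (T : I -> PV -> PV) u :
  normal_op k (fun v => \sum_(t <- r | P t) T t v) u
  = \sum_(t <- r | P t) normal_op k (T t) u.
Proof.
elim: k T u => [|k IH] T u; rewrite ?normal_op0 ?normal_opS; first by rewrite smul_suml.
rewrite -scaler_sumr; congr (_ *: _); rewrite exchange_big /=.
by apply: eq_bigr => g _; apply: IH.
Qed.

Lemma normal_opZ k (c : F) (T : PV -> PV) u :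
  normal_op k (fun v => c *: T v) u = c *: normal_op k T u.
Proof.
elim: k T u => [|k IH] T u; rewrite ?normal_op0 ?normal_opS; first by rewrite smulZl.
rewrite scalerA mulrC -scalerA; congr (_ *: _).
by rewrite scaler_sumr; apply: eq_bigr => g _; apply: IH.
Qed.

(** By Euler's formula the recursion returns T, one degree at a time. *)
Lemma normal_op_degree k (T : {linear PV -> PV}) u :
  in_degree k u -> normal_op k T u = T u.
Proof.
elim: k T u => [|k IH] T u ku; rewrite ?normal_op0 ?normal_opS.
  have [c ->] := in_degree0P ku.
  by rewrite (sconstE n c) !linearZ /= smulr1.
under eq_bigr => g _ do rewrite (IH _ _ (@in_degree_d_gen _ _ g _ _ ku)) /=.
rewrite -linear_sum (euler ku).
by rewrite linearZ scalerA mulVf ?scale1r // pnatr_eq0.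
Qed.

Lemma mul_gen_normal_op g k (T : PV -> PV) u :
  mul_gen g (normal_op k T u) = normal_op k (mul_gen g \o T) u.
Proof.
elim: k T u => [|k IH] T u; rewrite ?normal_op0 ?normal_opS; first by rewrite mul_gen_smul.
by rewrite linearZ linear_sum /=; congr (_ *: _); apply: eq_bigr => h _; rewrite IH.
Qed.

(** Moving d_g past x_h in the recursion yields delta_(g,h) once, and the sign
    of the remaining term cancels against that of exchanging d_g and d_h. *)
Lemma normal_op_d_gen g k (T : {linear PV -> PV}) u :
  normal_op k.+1 (T \o d_gen g) u = normal_op k T (d_gen g u).
Proof.
elim: k T u => [|k IH] T u.
  rewrite normal_opS invr1 scale1r (bigD1 g) //= big1 => [|h hg].
    rewrite normal_op0 /= d_mul_gen eqxx scale1r (d_gen_degree0 _ (@in_degree_sconst _ n 1)).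
    by rewrite linear0 scaler0 !addr0.
  rewrite normal_op0 /= d_mul_gen eq_sym (negPf hg) scale0r add0r.
  by rewrite (d_gen_degree0 _ (@in_degree_sconst _ n 1)) !(linear0, scaler0) smul0l.
rewrite normal_opS.
set k1 := k.+1.
have step h : normal_op k1 ((T \o d_gen g) \o mul_gen h) (d_gen h u)
   = (g == h)%:R *: normal_op k1 T (d_gen g u)
     + normal_op k (T \o mul_gen h) (d_gen h (d_gen g u)).
  transitivity (normal_op k1 (fun v => (g == h)%:R *: T v) (d_gen h u)
     + normal_op k1 (fun v => swap_sign F g h *: ((T \o mul_gen h) \o d_gen g) v) (d_gen h u)).
    (* Two summands are presented as a family indexed by the booleans, since
       additivity in T is stated for families. *)
    have := normal_op_sum k1 (index_enum bool) predT (fun b v => if b then (g == h)%:R *: T v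
       else swap_sign F g h *: ((T \o mul_gen h) \o d_gen g) v) (d_gen h u).
    rewrite !big_bool /= => <-; apply: (@eq_normal_op k1) => v _.
    by rewrite /= d_mul_gen big_bool linearD !linearZ.
  rewrite !normal_opZ IH; congr (_ + _).
    by case: eqP => [->|]; rewrite ?scale0r.
  rewrite d_genC linearZ /= scalerA -[RHS]scale1r; congr (_ *: _).
  by rewrite /swap_sign andbC; case: ifP => _; ring.
under eq_bigr => h _ do rewrite step.
rewrite big_split /= -scaler_suml (bigD1 g) //= eqxx big1 => [|h /negPf hg]; last first.
  by rewrite eq_sym hg.
rewrite addr0 (_ : \sum_h _ = k1%:R *: normal_op k1 T (d_gen g u)); last first.
  by rewrite normal_opS scalerA mulfV ?scale1r // pnatr_eq0.
by rewrite -scalerDl scalerA nat1r mulVf ?scale1r // pnatr_eq0.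
Qed.

(** The operators sum_w w d_w act like the divided powers of the degree
    operator; the induction step is l binomial(l-1, k) = (k+1) binomial(l, k+1). *)
Lemma normal_op_id k l u : in_degree l u -> normal_op k id u = 'C(l, k)%:R *: u.
Proof.
elim: k l u => [|k IH] l u lu; rewrite ?normal_op0 ?normal_opS; first by rewrite smul1 bin0 scale1r.
have E g : normal_op k (id \o mul_gen g) (d_gen g u)
    = 'C(l.-1, k)%:R *: mul_gen g (d_gen g u).
  rewrite (_ : normal_op k _ _ = mul_gen g (normal_op k id (d_gen g u))).
    by rewrite (IH l.-1) ?linearZ //; apply: in_degree_d_gen.
  by rewrite mul_gen_normal_op.
under eq_bigr => g _ do rewrite E.
rewrite -scaler_sumr (euler lu) !scalerA -natrM mulnC mul_bin_diag natrM.
by rewrite mulrA mulVf ?mul1r // pnatr_eq0.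
Qed.

Definition d_word (w : seq gen) u : PV := foldr (@d_gen F n) u w.

Lemma d_word_is_linear w : linear (d_word w).
Proof. by elim: w => [|g w IH] c u v //=; rewrite IH linearP. Qed.

HB.instance Definition _ w :=
  GRing.isLinear.Build F PV PV _ (d_word w) (d_word_is_linear w).

Lemma normal_op_d_word w u : normal_op (size w) (d_word w) u = d_word w u.
Proof.
elim/last_ind: w u => [|w g IH] u; first by rewrite normal_op0 smul1.
have E v : d_word (rcons w g) v = (d_word w \o d_gen g) v.
  by rewrite /d_word foldr_rcons.
by rewrite size_rcons (eq_normal_op (fun v _ => E v)) normal_op_d_gen IH E.
Qed.

(** Absorbing the derivations of a word one at a time with [normal_op_d_gen]
    turns the word into [normal_op] of itself.  Hence an element of D^k is
    determined by its restriction to P^k. *)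
Lemma diffop_normal_op k (d : PV -> PV) : is_diffop k d -> d =1 normal_op k d.
Proof.
case=> c dE u.
rewrite (eq_normal_op (fun v _ => dE v)) normal_op_sum dE; apply: eq_bigr => w _.
by rewrite normal_opZ -{2}(size_tuple w) normal_op_d_word.
Qed.

Lemma diffop_linear k (d : PV -> PV) : is_diffop k d -> linear d.
Proof.
move=> dk a u v.
by rewrite !(diffop_normal_op dk) linearP.
Qed.

Lemma diffop_comp k (d : PV -> PV) g :
  is_diffop k d -> is_diffop k.+1 (d \o d_gen g).
Proof.
case=> c dE; exists (fun w => \sum_w' c w' *+ (w == [tuple of rcons w' g])) => u.
rewrite /= dE; under [RHS]eq_bigr => w _ do rewrite scaler_suml.
rewrite exchange_big; apply: eq_bigr => w' _ /=.
rewrite (bigD1 [tuple of rcons w' g]) //= eqxx mulr1n foldr_rcons big1 ?addr0 //.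
by move=> w /negPf ->; rewrite mulr0n scale0r.
Qed.

Lemma diffop_sum k I (r : seq I) (d : I -> PV -> PV) :
  (forall t, is_diffop k (d t)) -> is_diffop k (fun u => \sum_(t <- r) d t u).
Proof.
move=> kd; elim: r => [|t r [c cE]].
  exists (fun _ => 0) => u; rewrite big_nil big1 // => w _; exact: scale0r.
have [c' c'E] := kd t; exists (fun w => c' w + c w) => u.
rewrite big_cons cE c'E -big_split; apply: eq_bigr => w _; exact/esym/scalerDl.
Qed.

Lemma diffopZ k (a : F) (d : PV -> PV) :
  is_diffop k d -> is_diffop k (fun u => a *: d u).
Proof.
case=> c cE; exists (fun w => a * c w) => u.
by rewrite cE scaler_sumr; apply: eq_bigr => w _; rewrite scalerA.
Qed.

(** A functional on P^k with values in the constants is realised in D^k: this is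
    the non-degeneracy of the pairing. *)
Lemma normal_op_diffop k (T : PV -> PV) :
  (forall u, in_degree k u -> in_degree 0 (T u)) -> is_diffop k (normal_op k T).
Proof.
elim: k T => [|k IH] T T0.
  have [c cE] := in_degree0P (T0 _ (@in_degree_sconst _ n 1)).
  exists (fun=> c) => u; rewrite normal_op0 cE (sconstE n c) smulZl smul1.
  rewrite (big_pred1 [tuple]) // => w; apply/esym/eqP; exact: tuple0.
have H g : is_diffop k.+1 (normal_op k (T \o mul_gen g) \o d_gen g).
  apply/diffop_comp/IH => u ku; exact/T0/in_degree_mul_gen.
have [c cE] := diffopZ k.+1%:R^-1 (diffop_sum (index_enum gen) H).
by exists c => u; rewrite -cE.
Qed.

End NormalOperators.

Arguments normal_op : simpl never.
Arguments d_gen : simpl never.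
Arguments mul_gen : simpl never.

(** * Falling factorials *)
Section Falling.
Variable F : numFieldType.
Implicit Types x y : F.

Lemma falling0 x : falling x 0 = 1.
Proof. by rewrite /falling big_ord0. Qed.

Lemma fallingS x i : falling x i.+1 = falling x i * (x - i%:R).
Proof. by rewrite /falling big_ord_recr. Qed.

Lemma fallingSl x i : falling x i.+1 = x * falling (x - 1) i.
Proof.
rewrite /falling big_ord_recl subr0; congr (_ * _); apply: eq_bigr => j _.
by rewrite /= /bump /= natrD; ring.
Qed.

Lemma falling_nat (a i : nat) : falling (a%:R : F) i = (a ^_ i)%:R.
Proof.
elim: i => [|i IH]; first by rewrite falling0.
rewrite fallingS IH ffactnSr natrM; have [ia|ai] := leqP i a; first by rewrite natrB.
by rewrite ffact_small // !mul0r.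
Qed.

Lemma falling_nat_small (a i : nat) : (a < i)%N -> falling (a%:R : F) i = 0.
Proof. by move=> ai; rewrite falling_nat ffact_small. Qed.

Lemma falling_self (i : nat) : falling (i%:R : F) i = i`!%:R.
Proof. by rewrite falling_nat ffactnn. Qed.

Lemma fact_neq0 (i : nat) : i`!%:R != 0 :> F.
Proof. by rewrite pnatr_eq0 -lt0n fact_gt0. Qed.

(** Up to nonzero integers, all denominators and eigenvalues in this proof are
    products of half-integers. *)
Lemma half_integer_neq0 (a b : nat) : a%:R - (b%:R + 2%:R^-1) != 0 :> F.
Proof.
apply/eqP => /(congr1 (fun z => z * 2%:R)); rewrite mul0r mulrBl mulrDl.
rewrite mulVf ?pnatr_eq0 // -!natrM natr1 => /eqP; rewrite subr_eq0 eqr_nat; lia.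
Qed.

Lemma half_integer_falling_neq0 (a b i : nat) :
  falling (a%:R - (b%:R + 2%:R^-1) : F) i != 0.
Proof.
rewrite /falling; apply/prodf_neq0 => j _.
by rewrite -addrA -opprD addrAC -natrD half_integer_neq0.
Qed.

Lemma falling_half_integer_neq0 (b i : nat) :
  falling (b%:R + 2%:R^-1 : F) i != 0.
Proof.
rewrite /falling; apply/prodf_neq0 => j _.
by rewrite -oppr_eq0 opprB half_integer_neq0.
Qed.

End Falling.

(** * The Laplacian and multiplication by R2 *)
Section Harmonic.
Variables (F : numFieldType) (n : nat).
Local Notation PV := (superpoly F n).
Local Notation gen := (option 'I_(n + n)).
Implicit Types (u v h : PV) (g : gen).
Local Notation theta := (n%:R + 2%:R^-1 : F).
Local Notation r2 := (smul (R2 F n)).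
Local Notation nab := (@nabla2 F n).
Local Notation xl i := (Some (lshift n i) : gen).
Local Notation xr i := (Some (rshift n i) : gen).

Lemma R2E u :
  r2 u = mul_gen None (mul_gen None u)
         - 2%:R *: \sum_(i < n) mul_gen (xr i) (mul_gen (xl i) u).
Proof.
rewrite /R2 smulDl -scaleN1r smulZl smulZl scaleN1r smul_suml.
congr (_ - _ *: _); first exact: (esym (mul_gen_smul None _ _)).
by apply: eq_bigr => i _; exact: (esym (mul_gen_smul (xr i) _ _)).
Qed.

Lemma nabla2E u :
  nab u = d_gen None (d_gen None u)
          - 2%:R *: \sum_(i < n) d_gen (xr i) (d_gen (xl i) u).
Proof. by []. Qed.

Lemma nabla2_is_linear : linear nab.
Proof.
move=> c u v; rewrite !nabla2E.
rewrite (eq_bigr (fun i => c *: d_gen (xr i) (d_gen (xl i) u)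
                           + d_gen (xr i) (d_gen (xl i) v))); last first.
  by move=> i _; rewrite !linearP.
rewrite big_split -scaler_sumr !(d_gen_is_linear None) scalerDr opprD scalerBr !scalerA.
by rewrite [2%:R * c]mulrC addrACA.
Qed.

HB.instance Definition _ :=
  GRing.isLinear.Build F PV PV _ (@nabla2 F n) nabla2_is_linear.

Lemma in_degree_R2 k u : in_degree k u -> in_degree k.+2 (r2 u).
Proof.
move=> ku; rewrite R2E -scaleN1r; apply: in_degreeD; first by do 2!apply: in_degree_mul_gen.
do 2!apply: in_degreeZ; apply: in_degree_sum => i _; by do 2!apply: in_degree_mul_gen.
Qed.

Lemma in_degree_nabla2 k u : in_degree k u -> in_degree k.-2 (nab u).
Proof.
move=> ku; rewrite nabla2E -scaleN1r; apply: in_degreeD; first by do 2!apply: in_degree_d_gen.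
do 2!apply: in_degreeZ; apply: in_degree_sum => i _; by do 2!apply: in_degree_d_gen.
Qed.

Lemma nabla2_small k u : in_degree k u -> (k < 2)%N -> nab u = 0.
Proof.
move=> ku k2; have dd g g' : d_gen g (d_gen g' u) = 0.
  by apply: d_gen_degree0; have := @in_degree_d_gen _ _ g' _ _ ku; case: k k2 {ku} => [|[|]].
by rewrite nabla2E dd big1 ?scaler0 ?subr0.
Qed.

Lemma in_degree_iter_R2 k j u : in_degree k u -> in_degree (k + j.*2) (iter j r2 u).
Proof.
move=> ku; elim: j => [|j IH]; first by rewrite addn0.
by rewrite iterS doubleS !addnS; apply: in_degree_R2.
Qed.

Lemma scoefN u S : scoef (- u) S = - scoef u S.
Proof. by rewrite -scaleN1r scoefZ scaleN1r. Qed.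

Lemma nabla2_R2_y u :
  d_gen None (d_gen None (mul_gen None (mul_gen None u)))
  = mul_gen None (mul_gen None (d_gen None (d_gen None u)))
    + 4%:R *: mul_gen None (d_gen None u) + 2%:R *: u.
Proof.
apply: superpolyP => S; rewrite /mul_gen !(scoefD, scoefZ, scoef_mul_y, scoef_d_y).
by rewrite !(derivM, derivX, derivD, mul1r) !scaler_nat; ring.
Qed.

(** The contribution of a single pair of odd variables to the commutator. *)
Lemma nabla2_R2_x i u :
  d_gen (xr i) (d_gen (xl i) (mul_gen (xr i) (mul_gen (xl i) u)))
  = mul_gen (xr i) (mul_gen (xl i) (d_gen (xr i) (d_gen (xl i) u)))
    + (mul_gen (xl i) (d_gen (xl i) u) + mul_gen (xr i) (d_gen (xr i) u)) - u.
Proof.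
have lr : (xl i == xr i) = false.
  by apply/eqP => -[]; have := ltn_ord i; lia.
have rl : (xr i == xl i) = false by rewrite eq_sym.
rewrite !(d_mul_gen, linearD, linearZ, linearN) /= !eqxx ?lr ?rl.
rewrite /swap_sign /= !scaleN1r !scale1r !scale0r !(add0r, addr0).
rewrite !(d_mul_gen, linearD, linearZ, linearN) /= !eqxx ?lr ?rl.
rewrite /swap_sign /= !scaleN1r !scale1r !scale0r !(add0r, addr0).
by rewrite !opprK [LHS](AC (2*2) (4*(3*2)*1)).
Qed.

Lemma nabla2_R2_xx i j u :
  j != i ->
  d_gen (xr i) (d_gen (xl i) (mul_gen (xr j) (mul_gen (xl j) u)))
  = mul_gen (xr j) (mul_gen (xl j) (d_gen (xr i) (d_gen (xl i) u))).
Proof.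
move=> /negPf ji.
have ll : (xl i == xl j) = false by rewrite eq_sym; apply/eqP => -[] /val_inj /eqP; rewrite ji.
have rr : (xr i == xr j) = false.
  by rewrite eq_sym; apply/eqP => -[] /addnI /val_inj /eqP; rewrite ji.
have lr : (xl i == xr j) = false by apply/eqP => -[]; have := ltn_ord i; lia.
have rl : (xr i == xl j) = false by apply/eqP => -[]; have := ltn_ord j; lia.
have d (a b : gen) v : (a == b) = false -> isSome a -> isSome b -> d_gen a (mul_gen b v) = - mul_gen b (d_gen a v).
  by rewrite d_mul_gen /swap_sign => -> -> -> /=; rewrite scale0r add0r scaleN1r.
rewrite (d _ _ _ lr) // (d _ _ _ ll) // !linearN opprK /=.
by rewrite (d _ _ _ rr) // (d _ _ _ rl) // linearN opprK.
Qed.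

Lemma sum_gen_split (f : gen -> PV) :
  \sum_g f g = f None + \sum_(i < n) (f (xl i) + f (xr i)).
Proof. by rewrite sum_gen big_split_ord big_split. Qed.

(** Only the y-part and equal pairs of odd variables contribute; the y-part gives
    4 y d_y + 2 and each of the n pairs gives 4 (x_l d_l + x_r d_r) - 4, so the
    Euler terms add up to 4k. *)
Lemma commutator k u : in_degree k u ->
  nab (r2 u) = r2 (nab u) + (4%:R * (k%:R + 1 - theta)) *: u.
Proof.
move=> ku.
have dyx i v : d_gen None (mul_gen (Some i) v) = mul_gen (Some i) (d_gen None v).
  by rewrite d_mul_gen /swap_sign scale0r add0r scale1r.
have dxy i v : d_gen (Some i) (mul_gen None v) = mul_gen None (d_gen (Some i) v).
  by rewrite d_mul_gen /swap_sign scale0r add0r scale1r.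
set Y := fun v => mul_gen None (mul_gen None v).
set DY := fun v => d_gen None (d_gen None v).
set X := fun i v => mul_gen (xr i) (mul_gen (xl i) v).
set DX := fun i v => d_gen (xr i) (d_gen (xl i) v).
set E := fun i => mul_gen (xl i) (d_gen (xl i) u) + mul_gen (xr i) (d_gen (xr i) u).
have DYX : DY (\sum_i X i u) = \sum_i X i (DY u).
  by rewrite /DY !linear_sum; apply: eq_bigr => i _; rewrite /X /= !dyx.
have DXY i : DX i (Y u) = Y (DX i u) by rewrite /DX /Y !dxy.
have DXX i : DX i (\sum_j X j u) = \sum_j X j (DX i u) + (E i - u).
  rewrite (bigD1 i) //= [X in _ = X + _](bigD1 i) //= /DX !linearD !linear_sum /=.
  rewrite /X nabla2_R2_x -/(E i) -!addrA; congr (_ + _).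
  rewrite [RHS]addrC !addrA; congr (_ + _).
  by apply: eq_bigr => j ji; rewrite nabla2_R2_xx.
have eul : k%:R *: u = mul_gen None (d_gen None u) + \sum_i E i.
  by rewrite -(euler ku) sum_gen_split.
have R2Y v : r2 v = Y v - 2%:R *: \sum_j X j v by exact: R2E.
have nabY v : nab v = DY v - 2%:R *: \sum_i DX i v by [].
have DYr : DY (r2 u) = DY (Y u) - 2%:R *: \sum_i X i (DY u).
  by rewrite -DYX R2Y /DY !linearB !linearZ.
set D := \sum_i DX i u.
have Dr : \sum_i DX i (r2 u)
    = Y D - 2%:R *: (\sum_j X j D + (\sum_i E i - n%:R *: u)).
  have DXB i v w : DX i (v - 2%:R *: w) = DX i v - 2%:R *: DX i w.
    by rewrite /DX !linearB !linearZ.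
  under eq_bigr => i _ do rewrite R2Y DXB DXY DXX.
  rewrite sumrB -scaler_sumr big_split sumrB sumr_const card_ord -(scaler_nat n u) /=.
  congr (_ - _ *: (_ + _)); first by rewrite /Y /D !linear_sum.
  by rewrite exchange_big; apply: eq_bigr => j _; rewrite /X /D !linear_sum.
rewrite nabY DYr Dr (R2Y (nab u)) nabY -/D /DY nabla2_R2_y -/(DY u).
have -> : Y (DY u - 2%:R *: D) = Y (DY u) - 2%:R *: Y D.
  by rewrite /Y !linearB !linearZ.
have -> : \sum_j X j (DY u - 2%:R *: D) = \sum_j X j (DY u) - 2%:R *: \sum_j X j D.
  rewrite (eq_bigr (fun j => X j (DY u) - 2%:R *: X j D)) => [|j _].
    by rewrite sumrB -scaler_sumr.
  by rewrite /X !linearB !linearZ.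
have -> : 4%:R * (k%:R + 1 - theta) = 4%:R * k%:R + 2%:R - 4%:R * n%:R by field.
have -> : mul_gen None (d_gen None u) = k%:R *: u - \sum_i E i by rewrite eul addrK.
rewrite -/(Y (DY u)).
move: (Y (DY u)) (\sum_j X j (DY u)) (Y D) (\sum_j X j D) (\sum_i E i) => a b c d e.
apply: superpolyP => S; rewrite !(scoefD, scoefN, scoefZ) -!mul_polyC; ring.
Qed.


End Harmonic.

(** * Decomposition into harmonics *)
Section LinearIterate.
Variables (R : pzRingType) (U : lmodType R) (f : {linear U -> U}) (j : nat).

Lemma iter_is_linear : linear (iter j f).
Proof. by elim: j => [|i IH] c u v //=; rewrite IH linearP. Qed.

HB.instance Definition _ :=
  GRing.isLinear.Build R U U _ (iter j f) iter_is_linear.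

End LinearIterate.

Section Decomposition.
Variables (F : numFieldType) (n : nat).
Local Notation PV := (superpoly F n).
Local Notation gen := (option 'I_(n + n)).
Implicit Types (u v h : PV) (g : gen).
Local Notation theta := (n%:R + 2%:R^-1 : F).
Local Notation r2 := (smul (R2 F n)).
Local Notation nab := (@nabla2 F n).

(** For h harmonic of degree m, nabla2 sends R2^j h to this multiple of
    R2^(j-1) h. *)
Definition nabla2_eigenvalue (m j : nat) : F := 4%:R * j%:R * ((m + j)%:R - theta).

Lemma nabla2_eigenvalue_neq0 m j : (0 < j)%N -> nabla2_eigenvalue m j != 0.
Proof.
by move=> j0; rewrite !mulf_neq0 ?pnatr_eq0 ?half_integer_neq0 // -lt0n.
Qed.

Lemma nabla2_iter_R2 m j h :
  harmonic m h -> nab (iter j.+1 r2 h) = nabla2_eigenvalue m j.+1 *: iter j r2 h.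
Proof.
case=> h0 mh; elim: j => [|j IH].
  by rewrite /= (commutator mh) h0 linear0 add0r; congr (_ *: _); rewrite /nabla2_eigenvalue; ring.
rewrite iterS (commutator (@in_degree_iter_R2 _ _ _ j.+1 _ mh)) IH linearZ /= -scalerDl.
congr (_ *: _); rewrite /nabla2_eigenvalue -addnn !natrD -!natr1; ring.
Qed.

(** The factor picked up by R2^j h, h harmonic of degree m, when nabla2 is
    applied t times; it vanishes for t > j. *)
Definition lower_coef (m j t : nat) : F :=
  4%:R ^+ t * falling j%:R t * falling ((m + j)%:R - theta) t.

Lemma lower_coef_small m j t : (j < t)%N -> lower_coef m j t = 0.
Proof. by move=> jt; rewrite /lower_coef falling_nat_small // mulr0 mul0r. Qed.

Lemma lower_coef_neq0 m j : lower_coef m j j != 0.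
Proof.
rewrite /lower_coef falling_self.
by rewrite !mulf_neq0 ?half_integer_falling_neq0 ?fact_neq0 ?expf_neq0 ?pnatr_eq0.
Qed.

Lemma iter_nabla2_iter_R2 m t j h :
  harmonic m h ->
  iter t nab (iter j r2 h) = lower_coef m j t *: iter (j - t) r2 h.
Proof.
move=> mh; elim: t => [|t IH].
  by rewrite /lower_coef expr0 !falling0 !mul1r scale1r subn0.
rewrite iterS IH linearZ /=; have [tj|jt] := ltnP t j; last first.
  by rewrite (eqP jt) /= mh.1 scaler0 lower_coef_small // scale0r.
rewrite -{1}(subnSK tj) (nabla2_iter_R2 _ mh) scalerA; congr (_ *: _).
rewrite subnSK // /lower_coef /nabla2_eigenvalue !fallingS exprS.
by rewrite !natrD !natrB ?(ltnW tj) //; ring.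
Qed.

(** By induction nabla2 u is a sum of terms R2^j h_j; since nabla2 R2 acts on each
    of them by a nonzero scalar, some v satisfies nabla2 (R2 v) = nabla2 u, and
    u - R2 v is harmonic. *)
Lemma decomposition k u : in_degree k u ->
  exists2 h : nat -> PV,
    (forall j, (j <= k./2)%N -> harmonic (k - j.*2) (h j))
  & u = \sum_(j < k./2.+1) iter j r2 (h j).
Proof.
elim/ltn_ind: k u => k IH u ku.
have [k2|k2] := ltnP k 2.
  have k0 : k./2 = 0%N by lia.
  exists (fun=> u) => [j|]; rewrite k0; last by rewrite big_ord1.
  by rewrite leqn0 => /eqP ->; rewrite subn0; split=> //; apply: nabla2_small ku _.
case: k k2 IH ku => [|[|k]] // _ IH ku.
have [//|h hh Eu] := IH k _ (nab u) (in_degree_nabla2 ku).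
pose w j := (nabla2_eigenvalue (k - j.*2) j.+1)^-1 *: h j.
have hw j : (j <= k./2)%N -> harmonic (k - j.*2) (w j : PV).
  move=> /hh [nh kh]; split; last exact: in_degreeZ.
  by rewrite /w linearZ /= nh scaler0.
exists (fun j => if j is j'.+1 then w j' else u - \sum_(i < k./2.+1) iter i.+1 r2 (w i)).
  case=> [|j] jk; last by rewrite doubleS !subSS; exact: hw.
  rewrite subn0; split.
    rewrite linearB linear_sum /= Eu -sumrB big1 // => i _.
    have ik : (i <= k./2)%N by rewrite -ltnS.
    have /= -> := nabla2_iter_R2 i (hw i ik).
    rewrite /w [iter i _ (_ *: _)]linearZ /= scalerA mulfV ?nabla2_eigenvalue_neq0 //.
    by rewrite scale1r subrr.
  rewrite -scaleN1r; apply: in_degreeD => //; apply/in_degreeZ/in_degree_sum => i _.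
  have [_ ih] := hw i (ltn_ord i).
  have := @in_degree_iter_R2 _ _ _ i.+1 _ ih.
  by rewrite (_ : (_ + _)%N = k.+2) //; have := ltn_ord i; rewrite ltnS; lia.
rewrite big_ord_recl /= subrK //.
Qed.

(** The eigenvalue of R2 nabla2 on V_(k-j,j). *)
Definition R2_nabla2_eigenvalue (k j : nat) : F := nabla2_eigenvalue (k - j.*2) j.

(** The difference of two eigenvalues is 4 (i - j) (k - (n + i + j) - 1/2), whose
    last factor is a half-integer. *)
Lemma R2_nabla2_eigenvalue_inj k i j :
  (i <= k./2)%N -> (j <= k./2)%N -> R2_nabla2_eigenvalue k i = R2_nabla2_eigenvalue k j -> i = j.
Proof.
move=> ik jk; rewrite /R2_nabla2_eigenvalue /nabla2_eigenvalue => /eqP.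
have E t : (t <= k./2)%N -> (k - t.*2 + t)%N = (k - t)%N by lia.
rewrite !E // -subr_eq0 !natrB; try lia.
have -> : 4%:R * i%:R * (k%:R - i%:R - theta) - 4%:R * j%:R * (k%:R - j%:R - theta)
  = 4%:R * (i%:R - j%:R) * (k%:R - ((n + i + j)%:R + 2%:R^-1)) :> F.
  by rewrite !natrD; ring.
rewrite !mulf_eq0 (negPf (half_integer_neq0 _ _ _)) orbF pnatr_eq0 /=.
by rewrite subr_eq0 eqr_nat => /eqP.
Qed.

Definition lagrange k j t u : PV :=
  (R2_nabla2_eigenvalue k j - R2_nabla2_eigenvalue k t)^-1 *: (r2 (nab u) - R2_nabla2_eigenvalue k t *: u).

(** Lagrange interpolation at the eigenvalues of R2 nabla2: being a polynomial in
    that operator, the projection is linear and preserves parity, without a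
    choice of decomposition. *)
Definition proj k j u : PV :=
  foldr (lagrange k j) u [seq t <- iota 0 k./2.+1 | t != j].

Lemma lagrange_is_linear k j t : linear (lagrange k j t).
Proof.
move=> c u v; rewrite /lagrange.
have -> : r2 (nab (c *: u + v)) = c *: r2 (nab u) + r2 (nab v) by rewrite !linearP.
rewrite [R2_nabla2_eigenvalue k t *: _]scalerDr opprD addrACA scalerDr scalerA [R2_nabla2_eigenvalue k t * c]mulrC -scalerA.
by rewrite -scalerBr !scalerA [_^-1 * c]mulrC.
Qed.

HB.instance Definition _ k j t :=
  GRing.isLinear.Build F PV PV _ (lagrange k j t) (lagrange_is_linear k j t).

Lemma proj_is_linear k j : linear (proj k j).
Proof.
move=> c u v; rewrite /proj; elim: filter => [|t s IH] //=.
by rewrite IH lagrange_is_linear.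
Qed.
HB.instance Definition _ k j :=
  GRing.isLinear.Build F PV PV _ (proj k j) (proj_is_linear k j).

Lemma R2_nabla2_iter k j h :
  (j <= k./2)%N -> harmonic (k - j.*2) h ->
  r2 (nab (iter j r2 h)) = R2_nabla2_eigenvalue k j *: iter j r2 h.
Proof.
case: j => [|j] jk kh.
  by rewrite /= kh.1 linear0 /R2_nabla2_eigenvalue /nabla2_eigenvalue mulr0 mul0r scale0r.
by rewrite (nabla2_iter_R2 _ kh) linearZ.
Qed.

Lemma proj_V k i j h :
  (i <= k./2)%N -> (j <= k./2)%N -> harmonic (k - i.*2) h ->
  proj k j (iter i r2 h) = (i == j)%:R *: iter i r2 h.
Proof.
move=> ik jk hh; rewrite /proj; set s := [seq _ <- _ | _].
have -> : foldr (lagrange k j) (iter i r2 h) s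
  = (\prod_(t <- s) ((R2_nabla2_eigenvalue k i - R2_nabla2_eigenvalue k t) / (R2_nabla2_eigenvalue k j - R2_nabla2_eigenvalue k t))) *: iter i r2 h.
  elim: s => [|t s IH]; first by rewrite big_nil scale1r.
  rewrite /= IH big_cons linearZ /= /lagrange (R2_nabla2_iter ik hh).
  by rewrite -scalerBl !scalerA; congr (_ *: _); ring.
congr (_ *: _); case: eqVneq => [->|ij].
  rewrite big_seq big1 // => t; rewrite mem_filter mem_iota ltnS => /and3P[tj _ tk].
  rewrite mulfV // subr_eq0; apply: contra tj => /eqP E.
  by rewrite (R2_nabla2_eigenvalue_inj jk tk E).
apply/eqP; rewrite prodf_seq_eq0; apply/hasP; exists i; last by rewrite subrr mul0r eqxx.
by rewrite mem_filter ij mem_iota ltnS.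
Qed.

End Decomposition.

(** * Vanishing and non-vanishing of harmonics, parity *)
Section HarmonicDimension.
Variables (F : numFieldType) (n : nat).
Local Notation PV := (superpoly F n).
Local Notation gen := (option 'I_(n + n)).
Implicit Types (u v h : PV) (g : gen) (S T : {set 'I_(n + n)}).
Local Notation r2 := (smul (R2 F n)).
Local Notation nab := (@nabla2 F n).

Lemma coef_d_x_eq0 i u a :
  (forall S, (scoef u S)`_a = 0) -> forall S, (scoef (d_gen (Some i) u) S)`_a = 0.
Proof.
move=> u0 S; rewrite scoef_d_x; case: ifP => _; first by rewrite coef0.
by rewrite coefZ u0 mulr0.
Qed.

Lemma coef_mul_x_eq0 i u a :
  (forall S, (scoef u S)`_a = 0) -> forall S, (scoef (mul_gen (Some i) u) S)`_a = 0.
Proof.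
move=> u0 S; rewrite /mul_gen scoef_mul_x; case: ifP => _; last by rewrite coef0.
by rewrite coefZ u0 mulr0.
Qed.

(** The equation nabla2 u = 0 expresses the coefficient of y^(a+2) through those of
    y^a, so u is determined by its coefficients of y^0 and y^1.  For m > 2n + 1
    these would have odd degree exceeding 2n. *)
Lemma harmonic_large m u : (n.*2.+1 < m)%N -> harmonic m u -> u = 0.
Proof.
move=> mn [u0 mu].
suff H a S : (scoef u S)`_a = 0.
  by apply: superpolyP => S; apply/polyP => a; rewrite H scoef0 coef0.
elim/ltn_ind: a S => -[|[|a]] IH S.
- by rewrite (in_degree_coef mu) //; have := max_card S; rewrite card_ord; lia.
- by rewrite (in_degree_coef mu) //; have := max_card S; rewrite card_ord; lia.
have := congr1 (fun v => (scoef v S)`_a) u0.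
rewrite nabla2E scoefD scoefN scoefZ scoef_sum !scoef_d_y scoef0 coef0.
rewrite coefB coefZ coef_sum big1 => [|i _].
  rewrite mulr0 subr0 !coef_deriv -mulrnA => /eqP.
  by rewrite mulrn_eq0 => /orP[|/eqP //].
by do 2!apply: coef_d_x_eq0 => ?; apply: IH.
Qed.

(** The leading term y^2 of R2 raises the highest power of y by two. *)
Lemma R2_low_degree u v :
  u = r2 v -> (forall S a, (1 < a)%N -> (scoef u S)`_a = 0) -> v = 0.
Proof.
move=> uv u0; have [T _ Tmax] := @arg_maxnP _ set0 predT (fun S => size (scoef v S)) isT.
have vT : scoef v T = 0.
  apply/eqP; rewrite -size_poly_eq0; apply/eqP.
  case E : (size _) => [|d] //; exfalso.
  have := u0 T d.+2 isT; rewrite uv R2E scoefD scoefN scoefZ scoef_sum.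
  rewrite /mul_gen !scoef_mul_y coefB coefZ coef_sum big1 => [|i _].
    rewrite mulr0 subr0 mulrA mulrC -expr2 coefMXn /= subn2 /= => /eqP.
    have -> : (scoef v T)`_d = lead_coef (scoef v T) by rewrite lead_coefE E.
    by rewrite lead_coef_eq0 -size_poly_eq0 E.
  do 2!apply: coef_mul_x_eq0 => ?; apply: nth_default.
  by apply: leq_trans (Tmax _ isT) _; rewrite E ltnW.
apply: superpolyP => S; rewrite scoef0; apply/eqP; rewrite -size_poly_eq0 -leqn0.
by apply: leq_trans (Tmax S isT) _; rewrite vT size_poly0.
Qed.

Definition mono (a : nat) (S : {set 'I_(n + n)}) : PV :=
  spoly (fun T => if T == S then 'X^a else 0).

Lemma in_degree_mono a S : in_degree (a + #|S|) (mono a S).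
Proof.
move=> T b; rewrite scoefE; case: (eqVneq T S) => [->|_]; last by rewrite coef0 eqxx.
by rewrite coefXn; case: (eqVneq b a) => [->|_]; rewrite ?eqxx.
Qed.

(** Otherwise every polynomial of degree m would be a multiple of R2, and so would
    x_S with #|S| = m, or y times the product of all the odd variables if m = 2n + 1,
    against [R2_low_degree]. *)
Lemma harmonic_exists m : (m <= n.*2.+1)%N -> exists2 h : PV, harmonic m h & h <> 0.
Proof.
move=> mn.
have [S cS] : exists S : {set 'I_(n + n)}, #|S| = minn m (n + n).
  (* The first min(m, 2n) indices; e below is 1 exactly when m = 2n + 1. *)
  exists [set widen_ord (geq_minr m (n + n)) i | i : 'I_(minn m (n + n))].
  by rewrite card_imset ?card_ord // => i j [] /val_inj.
pose e := (m - (n + n))%N.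
have dm : in_degree m (mono e S).
  by have := @in_degree_mono e S; rewrite cS (_ : (_ + _)%N = m) // /e; lia.
have [h hh Eu] := decomposition dm.
have [h0|/eqP h0] := eqVneq (h 0%N) 0; last by exists (h 0%N) => //; have := hh 0%N isT; rewrite subn0.
exfalso.
rewrite big_ord_recl /= h0 add0r in Eu.
have {Eu} Eu : mono e S = r2 (\sum_(i < m./2) iter i r2 (h i.+1)).
  by rewrite Eu linear_sum; apply: eq_bigr.
have v0 : \sum_(i < m./2) iter i r2 (h i.+1) = 0.
  apply: R2_low_degree Eu _ => T a a1.
  rewrite scoefE; case: ifP => _; last by rewrite coef0.
  by rewrite coefXn; case: (eqVneq a e) => // ae; move: a1; rewrite ae /e; lia.
have : (scoef (mono e S) S)`_e = 0 by rewrite Eu v0 linear0 scoef0 coef0.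
by rewrite scoefE eqxx coefXn eqxx => /eqP; rewrite oner_eq0.
Qed.

Lemma iter_R2_inj m j h : harmonic m h -> iter j r2 h = 0 -> h = 0.
Proof.
move=> mh h0; have := iter_nabla2_iter_R2 j j mh.
rewrite h0 linear0 subnn /= => /esym/eqP; rewrite scaler_eq0.
by rewrite (negPf (lower_coef_neq0 _ _ _ _)) => /eqP.
Qed.

(** Unlike [parity_homog], this fixes the parity, which makes it additive. *)
Definition parity (b : bool) u := forall S, odd #|S| != b -> scoef u S = 0.

Lemma parityP u : parity_homog u <-> exists b, parity b u.
Proof.
split=> -[b ub]; exists b => S.
  by apply: contraNeq => /ub ->.
by move=> uS; apply/eqP; apply: contraNT uS => /ub ->.
Qed.

Lemma parityD b u v : parity b u -> parity b v -> parity b (u + v).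
Proof. by move=> ub vb S Sb; rewrite scoefD ub ?vb ?addr0. Qed.

Lemma parityZ b c u : parity b u -> parity b (c *: u).
Proof. by move=> ub S Sb; rewrite scoefZ ub ?scaler0. Qed.

Lemma parity_sum b I (r : seq I) (P : pred I) (f : I -> PV) :
  (forall t, P t -> parity b (f t)) -> parity b (\sum_(t <- r | P t) f t).
Proof.
move=> fb; elim/big_rec: _ => [|t x Pt]; first by move=> S _; rewrite scoef0.
exact/parityD/fb.
Qed.

Lemma parity_mul_gen b g u : parity b u -> parity (b (+) g) (mul_gen g u).
Proof.
move=> ub S; case: g => [i|]; rewrite /mul_gen; last first.
  by rewrite addbF scoef_mul_y => /ub ->; rewrite mulr0.
rewrite scoef_mul_x addbT; case: ifP => // iS.
rewrite (cardsD1 i) iS /= => Sb; rewrite ub ?scaler0 //.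
by apply: contraNneq Sb => ->.
Qed.

Lemma parity_d_gen b g u : parity b u -> parity (b (+) g) (d_gen g u).
Proof.
move=> ub S; case: g => [i|]; last first.
  by rewrite addbF scoef_d_y => /ub ->; rewrite deriv0.
rewrite scoef_d_x addbT; case: ifP => // iS Sb; rewrite ub ?scaler0 //.
by rewrite cardsU1 iS /=; apply: contra Sb => /eqP <-; rewrite negbK.
Qed.

Lemma parity_R2 b u : parity b u -> parity b (r2 u).
Proof.
move=> ub; rewrite R2E -scaleN1r; apply: parityD.
  by have := @parity_mul_gen _ None _ (@parity_mul_gen _ None _ ub); rewrite !addbF.
do 2!apply: parityZ; apply: parity_sum => i _.
have := @parity_mul_gen _ (Some (rshift n i)) _ (@parity_mul_gen _ (Some (lshift n i)) _ ub).
by rewrite !addbT negbK.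
Qed.

Lemma parity_nabla2 b u : parity b u -> parity b (nab u).
Proof.
move=> ub; rewrite nabla2E -scaleN1r; apply: parityD.
  by have := @parity_d_gen _ None _ (@parity_d_gen _ None _ ub); rewrite !addbF.
do 2!apply: parityZ; apply: parity_sum => i _.
have := @parity_d_gen _ (Some (rshift n i)) _ (@parity_d_gen _ (Some (lshift n i)) _ ub).
by rewrite !addbT negbK.
Qed.

Lemma parity_proj b k j u : parity b u -> parity b (proj k j u).
Proof.
move=> ub; rewrite /proj; elim: [seq _ <- _ | _] => [|t s IH] //=.
apply/parityZ/parityD; first exact/parity_R2/parity_nabla2.
by rewrite -scaleN1r; do 2!apply: parityZ.
Qed.

Lemma parity_mono a S : parity (odd #|S|) (mono a S).
Proof. by move=> T; rewrite scoefE; case: (eqVneq T S) => [->|//]; rewrite eqxx. Qed.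

End HarmonicDimension.

(** * Normal ordering and the action of R2 and nabla2 *)
Section CapelliEigenvalue.
Variables (F : numFieldType) (n : nat).
Local Notation PV := (superpoly F n).
Local Notation gen := (option 'I_(n + n)).
Implicit Types (u v h : PV) (g : gen) (S T : {set 'I_(n + n)}).
Local Notation r2 := (smul (R2 F n)).
Local Notation nab := (@nabla2 F n).

Lemma R2_normal_op k (T : PV -> PV) u : r2 (normal_op k T u) = normal_op k (r2 \o T) u.
Proof.
(* Two summands are presented as a family indexed by the booleans, since
   additivity in T is stated for families. *)
have E v : (r2 \o T) v = \sum_(b <- [:: true; false]) if b then mul_gen None (mul_gen None (T v))
   else - 2%:R *: \sum_(i < n) mul_gen (Some (rshift n i)) (mul_gen (Some (lshift n i)) (T v)).
  by rewrite 2!big_cons big_nil addr0 scaleNr -R2E.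
rewrite (eq_normal_op (fun v _ => E v)).
rewrite (normal_op_sum k _ predT (fun b v => if b then mul_gen None (mul_gen None (T v))
   else - 2%:R *: \sum_(i < n) mul_gen (Some (rshift n i)) (mul_gen (Some (lshift n i)) (T v)))).
rewrite 2!big_cons big_nil addr0 normal_opZ normal_op_sum R2E !mul_gen_normal_op scaleNr.
by congr (_ - _ *: _); apply: eq_bigr => i _; rewrite !mul_gen_normal_op.
Qed.

Lemma normal_op_nabla2 k (T : {linear PV -> PV}) u :
  normal_op k.+2 (T \o nab) u = normal_op k T (nab u).
Proof.
pose Td g g' : PV -> PV := (T \o d_gen g) \o d_gen g'.
(* Two summands are presented as a family indexed by the booleans, since
   additivity in T is stated for families. *)
have E v : (T \o nab) v = \sum_(b <- [:: true; false]) if b then Td None None v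
   else - 2%:R *: \sum_(i < n) Td (Some (rshift n i)) (Some (lshift n i)) v.
  rewrite 2!big_cons big_nil addr0 scaleNr /= nabla2E linearB linearZ linear_sum.
  by [].
have d2 g g' : normal_op k.+2 (Td g g') u = normal_op k T (d_gen g (d_gen g' u)).
  by rewrite /Td normal_op_d_gen normal_op_d_gen.
rewrite (eq_normal_op (fun v _ => E v)).
rewrite (normal_op_sum _ _ predT (fun b v => if b then Td None None v
   else - 2%:R *: \sum_(i < n) Td (Some (rshift n i)) (Some (lshift n i)) v)).
rewrite 2!big_cons big_nil addr0 normal_opZ normal_op_sum d2 nabla2E linearB scaleNr /=.
congr (_ - _); rewrite [normal_op k T (_ *: _)]linearZ /=; congr (_ *: _).
by rewrite [RHS]linear_sum; apply: eq_bigr => i _; exact: d2.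
Qed.

Lemma iter_normal_op k j (T : {linear PV -> PV}) u :
  normal_op (k + j.*2) (iter j r2 \o T \o iter j nab) u
  = iter j r2 (normal_op k T (iter j nab u)).
Proof.
have L i (T' : PV -> PV) v : iter i r2 (normal_op k T' v) = normal_op k (iter i r2 \o T') v.
  elim: i => [|i IH] //=.
  by rewrite IH R2_normal_op; apply: eq_normal_op.
have K (T' : {linear PV -> PV}) v :
    normal_op (k + j.*2) (T' \o iter j nab) v = normal_op k T' (iter j nab v).
  elim: j v => [|i IH] v; first by rewrite addn0.
  rewrite doubleS !addnS iterSr -IH -normal_op_nabla2; apply: eq_normal_op => w _.
  by rewrite /= -iterSr.
by rewrite L K.
Qed.

(** Both sides act on R2^i h, h harmonic: for i < j the power of nabla2 kills it,
    and for i >= j it leaves a multiple of R2^(i-j) h, which the projection onto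
    the harmonics keeps only if i = j. *)
Lemma proj_shift m j u : in_degree (m + j.*2) u ->
  proj (m + j.*2) j u
  = (lower_coef F n m j j)^-1 *: (iter j r2 \o proj m 0 \o iter j nab) u.
Proof.
move=> ku; have [h hh ->] := decomposition ku.
rewrite !linear_sum /= ?scaler_sumr; apply: eq_bigr => -[i /= ik] _.
have {}hh := hh i ik.
rewrite proj_V //; last by lia.
rewrite (iter_nabla2_iter_R2 j i hh) !linearZ /= scalerA.
have [ij|ji] := ltnP i j.
  by rewrite lower_coef_small // mul0r (ltn_eqF ij) !scale0r.
have Em : (m + j.*2 - i.*2)%N = (m - (i - j).*2)%N by lia.
rewrite proj_V //; [|by lia|by rewrite -Em].
rewrite linearZ /= -iterD subnKC // scalerA.
congr (_ *: _); rewrite subn_eq0 eqn_leq ji andbT.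
have [ij|_] := leqP i j; last by rewrite mulr0.
have {ik ji Em hh ij} ij : i = j by apply/eqP; rewrite eqn_leq ij.
by rewrite ij (_ : (m + _ - _)%N = m) ?mulr1 ?divff ?lower_coef_neq0 //; lia.
Qed.

End CapelliEigenvalue.

(** * Bases extracted from a spanning family *)
Section ExtractBasis.
Variables (F : fieldType) (U : lmodType F) (I : finType) (w : I -> U).

(** The basis is a subfamily of w, so it inherits any property shared by the
    members of w, such as homogeneity; M records the coordinates of w. *)
Lemma extract_basis : exists (d : nat) (f : 'I_d -> I) (M : I -> 'I_d -> F),
  (forall c : 'I_d -> F, \sum_t c t *: w (f t) = 0 -> forall t, c t = 0)
  /\ (forall i, w i = \sum_t M i t *: w (f t)).
Proof.
suff [d [f [indep gen]]] : exists d (f : 'I_d -> I),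
    (forall c : 'I_d -> F, \sum_t c t *: w (f t) = 0 -> forall t, c t = 0)
    /\ (forall i, i \in enum I -> exists c : 'I_d -> F, w i = \sum_t c t *: w (f t)).
  have /fin_all_exists [M HM] i : exists c : 'I_d -> F, w i = \sum_t c t *: w (f t).
    by apply: gen; rewrite mem_enum.
  by exists d, f, M.
elim: (enum I) => [|i s [d [f [indep gen]]]].
  by exists 0%N, (fun t : 'I_0 => match notF (ltn_ord t) with end); split=> // c _ [].
have [[c cE]|nspan] := boolp.pselect (exists c : 'I_d -> F, w i = \sum_t c t *: w (f t)).
  exists d, f; split=> // j; rewrite inE => /orP[/eqP ->|/gen //].
  by exists c.
pose f' (t : 'I_d.+1) := if unlift ord0 t is Some t' then f t' else i.
have f'0 : f' ord0 = i by rewrite /f' unlift_none.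
have f'S t : f' (lift ord0 t) = f t by rewrite /f' liftK.
exists d.+1, f'; split=> [c|j].
  rewrite big_ord_recl f'0 => c0.
  have {}c0 : c ord0 *: w i + \sum_t c (lift ord0 t) *: w (f t) = 0.
    by rewrite -[RHS]c0; congr (_ + _); apply: eq_bigr => t _; rewrite f'S.
  have z0 : c ord0 = 0.
    apply/eqP; apply/negPn/negP => cn0; apply: nspan.
    exists (fun t => - (c ord0)^-1 * c (lift ord0 t)).
    under eq_bigr => t _ do rewrite -scalerA.
    rewrite -scaler_sumr; move/eqP: c0; rewrite addrC addr_eq0 => /eqP ->.
    by rewrite scalerN scaleNr opprK scalerA mulVf // scale1r.
  move=> t; case: (unliftP ord0 t) => [t'|] ->; last exact: z0.
  by apply: (indep (fun t => c (lift ord0 t))); rewrite -[RHS]c0 z0 scale0r add0r.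
rewrite inE => /orP[/eqP ->|/gen [c cE]].
  exists (fun t => (t == ord0)%:R); rewrite big_ord_recl f'0 eqxx scale1r big1 ?addr0 //.
  by move=> t _; rewrite scale0r.
exists (fun t => if unlift ord0 t is Some t' then c t' else 0).
rewrite big_ord_recl unlift_none scale0r add0r cE; apply: eq_bigr => t _.
by rewrite liftK f'S.
Qed.

End ExtractBasis.

(** * Recursion for the scalars *)
Section CapelliOperators.
Variables (F : numFieldType) (n : nat).
Local Notation PV := (superpoly F n).
Implicit Types (u v h : PV) (S T : {set 'I_(n + n)}) (nu mu : nat * nat).
Local Notation r2 := (smul (R2 F n)).
Local Notation nab := (@nabla2 F n).

Lemma sum_proj k u : in_degree k u -> u = \sum_(j < k./2.+1) proj k j u.
Proof.
case/decomposition=> h hh ->.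
under [RHS]eq_bigr => j _ do rewrite linear_sum.
rewrite exchange_big /=; apply: eq_bigr => i _.
have ik (j : 'I_(k./2).+1) : (j <= k./2)%N by rewrite -ltnS.
rewrite (bigD1 i) //= (proj_V (ik i) (ik i) (hh _ (ik i))) eqxx scale1r.
rewrite big1 ?addr0 // => j ji.
rewrite (proj_V (ik i) (ik j) (hh _ (ik i))) (_ : (i == j :> nat) = false) ?scale0r //.
by apply/negbTE; rewrite eq_sym.
Qed.

Lemma normal_op_proj_shift m j u :
  normal_op (m + j.*2) (proj (m + j.*2) j) u
  = (lower_coef F n m j j)^-1 *: iter j r2 (normal_op m (proj m 0) (iter j nab u)).
Proof.
rewrite (eq_normal_op (@proj_shift F n m j)) normal_opZ; congr (_ *: _).
exact: (iter_normal_op m j (proj m 0)).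
Qed.

(** Strong induction on m.  In sum_j D_(m-j,j) = binomial(E, m) the terms with
    j > 0 are multiples of R2^j D_(m-2j,0) nabla2^j, on which the induction
    hypothesis applies; what remains is the term j = 0. *)
Lemma normal_op_proj_scalar (c : nat -> nat -> nat -> F) :
  (forall m p q, \sum_(j < m./2.+1)
     (lower_coef F n (m - j.*2) j j)^-1 * lower_coef F n p q j * c (m - j.*2)%N p (q - j)%N
     = 'C(p + q.*2, m)%:R) ->
  forall m p q h, harmonic p h ->
    normal_op m (proj m 0) (iter q r2 h) = c m p q *: iter q r2 h.
Proof.
move=> cE; elim/ltn_ind=> m IH p q h hh.
have E := normal_op_id m (@in_degree_iter_R2 _ _ _ q _ hh.2).
rewrite (eq_normal_op (@sum_proj m)) normal_op_sum big_ord_recl /= in E.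
have := cE m p q; rewrite big_ord_recl /= double0 !subn0.
have V0 a b : lower_coef F n a b 0 = 1 by rewrite /lower_coef expr0 !falling0 !mulr1.
rewrite !V0 invr1 !mul1r => Ec.
rewrite -Ec scalerDl in E.
set A := \sum_(i < m./2) _ in E; set B := \sum_(i < m./2) _ in E.
suff AB : A = B *: iter q r2 h by move: E; rewrite AB => /addIr.
rewrite /A /B scaler_suml; apply: eq_bigr => i _.
have : (0 < bump 0 i <= m./2)%N by rewrite /bump /=; exact: ltn_ord.
move: (bump 0 i) => j /andP[j0 jm].
have Em : m = (m - j.*2 + j.*2)%N by lia.
rewrite {1 2}Em normal_op_proj_shift (iter_nabla2_iter_R2 j q hh) !linearZ /=.
rewrite (IH _ _ _ _ _ hh); last by lia.
rewrite [iter j _ _]linearZ /= !scalerA -iterD.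
have [qj|jq] := ltnP q j.
  by rewrite lower_coef_small // !(mul0r, mulr0, scale0r).
by rewrite subnKC //; congr (_ *: _); ring.
Qed.

End CapelliOperators.

(** * Existence and uniqueness of Capelli operators *)
Section CapelliBasis.
Variables (F : numFieldType) (n : nat).
Local Notation PV := (superpoly F n).
Local Notation gen := (option 'I_(n + n)).
Implicit Types (u v h : PV) (S T : {set 'I_(n + n)}) (nu mu : nat * nat).

Definition capelli_op nu : PV -> PV := normal_op (weight nu) (proj (weight nu) nu.2).

Lemma weight_part nu : is_part nu ->
  [/\ weight nu = (nu.1 - nu.2 + nu.2.*2)%N, (nu.2 <= (weight nu)./2)%N
    & (weight nu - nu.2.*2)%N = (nu.1 - nu.2)%N].
Proof. by rewrite /is_part /weight => nup; split; lia. Qed.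

Lemma V_degree nu u : is_part nu -> V_ nu u -> in_degree (weight nu) u.
Proof.
move=> /weight_part[-> _ _] [h [_ hd] ->]; exact: in_degree_iter_R2.
Qed.

Lemma proj_V_id nu u : is_part nu -> V_ nu u -> proj (weight nu) nu.2 u = u.
Proof.
move=> /weight_part[_ nk kE] [h hh ->].
by rewrite proj_V ?kE // eqxx scale1r.
Qed.

Lemma proj_V_other nu nu' u : is_part nu -> is_part nu' ->
  weight nu' = weight nu -> nu' <> nu -> V_ nu' u ->
  proj (weight nu) nu.2 u = 0.
Proof.
move=> pnu pnu' kk ne [h hh ->].
have [_ nk _] := weight_part pnu; have [_ nk' kE] := weight_part pnu'.
rewrite kk in nk' kE; rewrite proj_V ?kE //.
case: eqP => [e2|_]; last by rewrite scale0r.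
case: ne; move: kk e2; rewrite /weight.
by case: nu nu' {pnu pnu' nk nk' kE hh} => [a b] [a' b'] /= kk e2; congr (_, _); lia.
Qed.

Lemma proj_in_V nu u : is_part nu -> in_degree (weight nu) u ->
  V_ nu (proj (weight nu) nu.2 u).
Proof.
move=> /weight_part[_ nk kE] /decomposition[h hh ->].
exists (h nu.2); first by rewrite -kE; apply: hh.
have jk : (nu.2 < (weight nu)./2.+1)%N by [].
rewrite linear_sum (bigD1 (Ordinal jk)) //= (proj_V nk nk (hh _ nk)) eqxx scale1r.
rewrite big1 ?addr0 // => i ij; have ik : (i <= (weight nu)./2)%N by rewrite -ltnS.
rewrite (proj_V ik nk (hh _ ik)) (_ : (i == nu.2 :> nat) = false) ?scale0r //.
by apply/negbTE.
Qed.

(** The values of T on P^k are constants, so multiplying them by v on the left is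
    compatible with the evaluation at 1 that starts the recursion. *)
Lemma smul_normal_op k v (T : PV -> PV) u :
  (forall w, in_degree k w -> in_degree 0 (T w)) ->
  smul v (normal_op k T u) = normal_op k (fun w => smul v (T w)) u.
Proof.
elim: k T u => [|k IH] T u T0.
  have [c cE] := in_degree0P (T0 _ (@in_degree_sconst _ n 1)).
  by rewrite !normal_op0 cE (sconstE n c) smulZl smul1 !linearZ /= smulr1 smulZl.
rewrite !normal_opS linearZ linear_sum; congr (_ *: _); apply: eq_bigr => g _.
by rewrite [LHS]IH // => w kw; exact/T0/in_degree_mul_gen.
Qed.

Lemma diffop_degree0 k (d : PV -> PV) u :
  is_diffop k d -> in_degree k u -> in_degree 0 (d u).
Proof.
case=> c dE ku; rewrite dE; apply: in_degree_sum => w _; apply: in_degreeZ.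
have H (s : seq gen) v l : in_degree l v -> in_degree (l - size s) (d_word s v).
  elim: s => [|g s IH] lv; first by rewrite subn0.
  by rewrite subnS; apply/in_degree_d_gen/IH.
by have := H (val w) u k ku; rewrite size_tuple subnn.
Qed.

(** The monomial of degree k with odd part x_S.  No such monomial exists if
    #|S| > k; the value 0 allows all S to serve as indices. *)
Definition degree_mono k S : PV := if (#|S| <= k)%N then mono F (k - #|S|) S else 0.

Lemma in_degree_degree_mono k S : in_degree k (degree_mono k S).
Proof.
rewrite /degree_mono; case: ifP => [Sk|_]; last exact: in_degree0.
by have := @in_degree_mono F n (k - #|S|) S; rewrite subnK.
Qed.

Lemma monomial_expansion k u : in_degree k u ->
  u = \sum_S (scoef u S)`_(k - #|S|) *: degree_mono k S.
Proof.
move=> ku; apply: superpolyP => T; rewrite scoef_sum (bigD1 T) //=.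
rewrite big1 ?addr0 => [|S ST]; last first.
  rewrite scoefZ /degree_mono; case: ifP => _; last by rewrite scoef0 scaler0.
  by rewrite scoefE eq_sym (negPf ST) scaler0.
apply/polyP => a; rewrite scoefZ /degree_mono coefZ; case: ifP => Tk.
  rewrite scoefE eqxx coefXn.
  case: (eqVneq a (k - #|T|)%N) => [->|ak]; first by rewrite mulr1.
  by rewrite mulr0 (in_degree_coef ku) //; lia.
by rewrite scoef0 coef0 mulr0 (in_degree_coef ku) //; lia.
Qed.

(** The projections of the monomials span V_nu and are homogeneous, so a basis can
    be chosen among them.  The coordinates of the projection are then functionals
    on P^k that vanish on the other components: realised in D^k, they form the
    dual basis. *)
Lemma capelli_is_capelli nu : is_part nu -> is_capelli nu (capelli_op nu).
Proof.
move=> pnu; set k := weight nu.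
pose pr : {linear PV -> PV} := @proj F n k nu.2.
have [d [f [M [indep gen]]]] := extract_basis (fun S => pr (degree_mono k S)).
pose v t := pr (degree_mono k (f t)).
pose phi t u := \sum_S (scoef u S)`_(k - #|S|) * M S t.
have prE u : in_degree k u -> pr u = \sum_t phi t u *: v t.
  move=> ku; rewrite {1}(monomial_expansion ku) linear_sum.
  under eq_bigr => S _ do rewrite linearZ /= gen scaler_sumr.
  rewrite exchange_big; apply: eq_bigr => t _.
  by rewrite scaler_suml; apply: eq_bigr => S _; rewrite scalerA.
have phi_unique u (c : 'I_d -> F) : in_degree k u -> pr u = \sum_t c t *: v t ->
    forall t, phi t u = c t.
  move=> ku prc t; apply/eqP; rewrite -subr_eq0; apply/eqP.
  apply: (indep (fun t => phi t u - c t)).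
  under eq_bigr => t' _ do rewrite scalerBl.
  by rewrite sumrB -(prE u ku) -prc subrr.
have phiL t : linear (fun u => sconst n (phi t u) : PV).
  move=> c u u'; rewrite /= ![sconst n (phi _ _)]sconstE scalerA -scalerDl.
  congr (_ *: _); rewrite /phi mulr_sumr -big_split; apply: eq_bigr => S _.
  by rewrite scoefD scoefZ coefD coefZ /= mulrDl mulrA.
pose T t : {linear PV -> PV} :=
  HB.pack (fun u => sconst n (phi t u) : PV) (GRing.isLinear.Build F PV PV _ _ (phiL t)).
have vV t : V_ nu (v t) by apply: proj_in_V => //; apply: in_degree_degree_mono.
have vk t := V_degree pnu (vV t).
exists d, v, (fun t => normal_op k (T t)); split.
- split=> // u uV; exists (fun t => phi t u).
  by rewrite -prE ?[pr u]proj_V_id //; apply: V_degree.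
- move=> t; apply/parityP; exists (odd #|f t|); apply: parity_proj.
  rewrite /degree_mono; case: ifP => _; first exact: parity_mono.
  by move=> S _; rewrite scoef0.
- move=> t; split; first by apply: normal_op_diffop => u _; apply: in_degree_sconst.
  move=> nu' /and3P[pnu' /eqP kk _] ne u uV.
  have ku : in_degree k u by rewrite /k -kk; apply: V_degree uV.
  rewrite normal_op_degree //= (phi_unique u (fun=> 0)) //.
    by rewrite sconstE scale0r.
  rewrite [pr u](proj_V_other pnu pnu') // big1 // => t' _; exact: scale0r.
- move=> t t'; rewrite normal_op_degree //=; congr (sconst n _).
  apply: (phi_unique _ (fun t => (t == t')%:R)); first exact: vk.
  rewrite [pr _]proj_V_id // (bigD1 t') //= eqxx scale1r big1 ?addr0 //.
  by move=> t'' /negPf ->; rewrite scale0r.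
move=> u; under [RHS]eq_bigr => t _.
  rewrite smul_normal_op; last by move=> w _; apply: in_degree_sconst.
  over.
rewrite /= -normal_op_sum; apply: eq_normal_op => w kw.
rewrite [LHS](prE w kw); apply: eq_bigr => t _.
by rewrite sconstE linearZ /= smulr1.
Qed.

(** Let v_i and v_i^* be the given dual bases.  Each v_i^* is [normal_op] of itself,
    so the operator is [normal_op] of sum_i v_i v_i^*, which on P^k is the
    projection onto V_nu.  That v_i^* kills all of the other components, while
    [V_dual] speaks only of the partitions in [Pstar], uses the vanishing of
    high-degree harmonics. *)
Lemma capelli_unique nu D : Lambda_star n nu -> is_capelli nu D -> D =1 capelli_op nu.
Proof.
case=> k0 /and3P[pnu _ _]; set k := weight nu.
case=> d [v [vs [[vV indep gen] _ vsV dual DE]]] u.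
have vsk i := (vsV i).1.
rewrite DE; under eq_bigr => i _.
  rewrite (diffop_normal_op (vsk i)) smul_normal_op; last by move=> w; apply: diffop_degree0.
  over.
rewrite -normal_op_sum; apply: eq_normal_op => {}u ku.
pose L i : {linear PV -> PV} :=
  HB.pack (vs i) (GRing.isLinear.Build F PV PV _ _ (diffop_linear (vsk i))).
have vs_proj i : vs i u = vs i (proj k nu.2 u).
  rewrite -[vs i]/(L i : PV -> PV) {1}(sum_proj ku) linear_sum.
  have [_ nk _] := weight_part pnu.
  have jk : (nu.2 < k./2.+1)%N by [].
  rewrite (bigD1 (Ordinal jk)) //= big1 ?addr0 // => j jnu.
  have jk2 : (j <= k./2)%N by rewrite -ltnS.
  pose nu' := ((k - j)%N, j : nat).
  have pnu' : is_part nu' by rewrite /is_part /=; lia.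
  have kk : weight nu' = k by rewrite /weight /=; lia.
  have := @proj_in_V nu' u pnu'; rewrite kk => /(_ ku).
  have [st|nst] := boolP (k./2 <= j + n)%N.
    apply: (vsV i).2; first by rewrite /Pstar pnu' kk eqxx.
    by move=> e; move: jnu; rewrite -val_eqE /= -[X in _ != X]/(nu.2) -e eqxx.
  case=> h hh ->; have -> : h = 0.
    by apply: harmonic_large hh; rewrite /nu' /=; move: nst jk2; lia.
  rewrite linear0; exact: (linear0 (L i)).
have [c cE] := gen _ (proj_in_V pnu ku).
rewrite [RHS]cE; apply: eq_bigr => i _; rewrite vs_proj cE.
have vsZ j : vs i (c j *: v j) = c j *: sconst n (i == j)%:R.
  by rewrite -dual -[vs i]/(L i : PV -> PV) linearZ.
rewrite -[vs i]/(L i : PV -> PV) linear_sum (bigD1 i) //= big1 ?addr0 => [|j ji].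
  by rewrite vsZ eqxx !linearZ /= smulr1.
by rewrite vsZ eq_sym (negPf ji) sconstE scale0r scaler0.
Qed.

End CapelliBasis.

(** * Knop-Sahi polynomials *)
Section KnopSahiFunction.
Variables (F : numFieldType) (n : nat).
Local Notation theta := (n%:R + 2%:R^-1 : F).

Lemma falling_add (x : F) a b : falling x (a + b) = falling x a * falling (x - a%:R) b.
Proof.
elim: b => [|b IH]; first by rewrite addn0 falling0 mulr1.
by rewrite addnS !fallingS IH natrD -mulrA opprD addrA.
Qed.

Lemma falling_vandermonde (x y : F) m :
  falling (x + y) m
  = \sum_(i < m.+1) 'C(m, i)%:R * falling x i * falling y (m - i).
Proof.
elim: m => [|m IH]; first by rewrite big_ord1 !falling0 bin0 !mulr1.
rewrite fallingS IH mulr_suml.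
have step (i : 'I_m.+1) :
    'C(m, i)%:R * falling x i * falling y (m - i) * (x + y - m%:R)
    = 'C(m, i)%:R * falling x i.+1 * falling y (m - i)
      + 'C(m, i)%:R * falling x i * falling y (m.+1 - i).
  have im : (i <= m)%N by rewrite -ltnS.
  by rewrite subSn // !fallingS natrB //; ring.
under eq_bigr => i _ do rewrite step.
rewrite big_split /=.
have -> : \sum_(i < m.+1) 'C(m, i)%:R * falling x i * falling y (m.+1 - i)
        = \sum_(i < m.+2) 'C(m, i)%:R * falling x i * falling y (m.+1 - i).
  by rewrite [RHS]big_ord_recr /= bin_small // !mul0r addr0.
rewrite [X in _ + X]big_ord_recl [RHS]big_ord_recl addrCA -big_split !bin0.
congr (_ + _); apply: eq_bigr => i _.
by rewrite /= /bump /= !add1n subSS binS natrD; ring.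
Qed.

(** The coefficients of P_(m,0), normalised to take the value 1 at (m,0), in the
    basis of products of a falling factorial of x and one of y.  They are symmetric
    in i and l. *)
Definition ks_coef m i l : F :=
  falling theta (m - i) * falling theta (m - l)
  / (i`!%:R * l`!%:R * (m - i - l)`!%:R * falling theta m).

Definition ks_fun m (x y : F) : F :=
  \sum_(i < m.+1) \sum_(l < m.+1 | (i + l <= m)%N)
     ks_coef m i l * falling x l * falling y i.

End KnopSahiFunction.

Section SymmetricBivariate.
Variables (F : numFieldType) (n : nat).
Local Notation theta := (n%:R + 2%:R^-1 : F).
Local Notation MP := {mpoly F[2]}.
Implicit Types (P X Y : MP).
Local Notation X0 := ('X_ord0 : MP).
Local Notation X1 := ('X_ord_max : MP).

Definition mfall X i : MP := \prod_(t < i) (X - t%:R).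

Lemma mfall0 X : mfall X 0 = 1. Proof. by rewrite /mfall big_ord0. Qed.
Lemma mfallS X i : mfall X i.+1 = mfall X i * (X - i%:R).
Proof. by rewrite /mfall big_ord_recr. Qed.

Lemma meval_nat (v : 'I_2 -> F) i : (i%:R : MP).@[v] = i%:R.
Proof. exact: rmorph_nat. Qed.

Lemma meval_mfall v X i : (mfall X i).@[v] = falling (X.@[v]) i.
Proof.
rewrite /mfall rmorph_prod; apply: eq_bigr => t _.
by rewrite /= mevalB meval_nat.
Qed.

Lemma eval2_X0 a b : eval2 X0 a b = a. Proof. by rewrite /eval2 mevalXU. Qed.
Lemma eval2_X1 a b : eval2 X1 a b = b. Proof. by rewrite /eval2 mevalXU. Qed.

Definition deg_le d P := (msize P <= d.+1)%N.

Lemma deg_leD d P Q : deg_le d P -> deg_le d Q -> deg_le d (P + Q).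
Proof. move=> dP dQ; apply: leq_trans (mmeasureD_le _ _ _) _; rewrite geq_max; exact/andP. Qed.
Lemma deg_leZ d c P : deg_le d P -> deg_le d (c *: P).
Proof. exact: leq_trans (msizeZ_le _ _). Qed.
Lemma deg_leM a b d P Q : (a + b <= d)%N -> deg_le a P -> deg_le b Q -> deg_le d (P * Q).
Proof.
move=> abd; rewrite /deg_le.
have [->|P0] := eqVneq P 0; first by rewrite mul0r mmeasure0.
have [->|Q0] := eqVneq Q 0; first by rewrite mulr0 mmeasure0.
by rewrite msizeM //; move: (mmeasure _ P) (mmeasure _ Q) => p q; lia.
Qed.
Lemma deg_le_sum d I (r : seq I) (A : pred I) (f : I -> MP) :
  (forall t, A t -> deg_le d (f t)) -> deg_le d (\sum_(t <- r | A t) f t).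
Proof.
move=> df; elim/big_rec: _ => [|t Q At]; first by rewrite /deg_le mmeasure0.
exact/deg_leD/df.
Qed.
Lemma deg_le_nat d i : deg_le d (i%:R : MP).
Proof.
by rewrite /deg_le -mpolyC_nat mmeasureC; case: (_ != _).
Qed.
Lemma deg_leX i : deg_le 1 ('X_i : MP).
Proof. by rewrite /deg_le msizeX mdeg1. Qed.
Lemma deg_leB d P Q : deg_le d P -> deg_le d Q -> deg_le d (P - Q).
Proof. by move=> dP dQ; rewrite -scaleN1r; apply/deg_leD/deg_leZ. Qed.
Lemma deg_le_mfall X i : deg_le 1 X -> deg_le i (mfall X i).
Proof.
move=> dX; elim: i => [|i IH]; first by rewrite mfall0 /deg_le msize1.
rewrite mfallS; apply: deg_leM IH _; last exact: deg_leB dX (deg_le_nat 1 i).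
by rewrite addn1.
Qed.

Definition swap : 'S_2 := tperm ord0 ord_max.

(** The transposition is the only nontrivial permutation of two variables. *)
Lemma swap_symmetric P : msym swap P = P -> P \is symmetric.
Proof.
move=> Ps; apply/issymP => s.
have [s1|st] : s = 1%g \/ s = swap; last by rewrite st.
  have I2 (i : 'I_2) : i = ord0 \/ i = ord_max.
    by case: i => -[|[|]] // p; [left|right]; apply: val_inj.
  have inj : s ord0 <> s ord_max by move/perm_inj.
  case: (I2 (s ord0)) => s0; case: (I2 (s ord_max)) => s1; move: inj; rewrite s0 s1 // => _.
    by left; apply/permP => i; rewrite perm1; case: (I2 i) => ->.
  by right; apply/permP => i; case: (I2 i) => ->; rewrite /swap ?tpermL ?tpermR.
by rewrite s1 msym1m.
Qed.

Lemma msym_nat s i : msym s (i%:R : MP) = i%:R.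
Proof. exact: rmorph_nat. Qed.

Lemma msym_mfall s X i : msym s (mfall X i) = mfall (msym s X) i.
Proof.
rewrite /mfall rmorph_prod; apply: eq_bigr => t _.
by rewrite /= msymB msym_nat.
Qed.

Lemma msym_U (s : 'S_2) i : msym s ('X_i : MP) = 'X_(s i).
Proof.
rewrite msymX; congr mpolyX; apply/mnmP => j; rewrite mnmE !mnm1E.
by rewrite -(inj_eq (@perm_inj _ s)) permKV.
Qed.

Lemma msym_swap0 : msym swap X0 = X1. Proof. by rewrite msym_U tpermL. Qed.
Lemma msym_swap1 : msym swap X1 = X0. Proof. by rewrite msym_U tpermR. Qed.

(** A substitute for (x y)^j that vanishes wherever the second coordinate is a
    natural number smaller than j. *)
Definition fall_prod j : MP := mfall X0 j * mfall X1 j.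

Definition ks_mpoly m X Y : MP :=
  \sum_(i < m.+1) \sum_(l < m.+1 | (i + l <= m)%N)
     ks_coef F n m i l *: (mfall X l * mfall Y i).

Lemma meval_ks_mpoly v m X Y : (ks_mpoly m X Y).@[v] = ks_fun n m X.@[v] Y.@[v].
Proof.
rewrite /ks_mpoly linear_sum; apply: eq_bigr => i _; rewrite linear_sum.
apply: eq_bigr => l _.
by rewrite [LHS]mevalZ mevalM !meval_mfall mulrA.
Qed.

Lemma ks_mpolyC m X Y : ks_mpoly m X Y = ks_mpoly m Y X.
Proof.
rewrite /ks_mpoly (exchange_big_dep xpredT) //=.
apply: eq_bigr => i _; apply: eq_big => [l|l _]; first by rewrite addnC.
rewrite [mfall X _ * _]mulrC; congr (_ *: _); rewrite /ks_coef.
by rewrite -!subnDA [(i + l)%N]addnC; congr (_ / _); ring.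
Qed.

Lemma msym_ks_mpoly s m X Y :
  msym s (ks_mpoly m X Y) = ks_mpoly m (msym s X) (msym s Y).
Proof.
rewrite /ks_mpoly linear_sum; apply: eq_bigr => i _; rewrite linear_sum.
apply: eq_bigr => l _.
by rewrite [LHS]msymZ msymM !msym_mfall.
Qed.

Lemma deg_le_ks_mpoly m X Y :
  deg_le 1 X -> deg_le 1 Y -> deg_le m (ks_mpoly m X Y).
Proof.
move=> dX dY; apply: deg_le_sum => i _; apply: deg_le_sum => l il; apply: deg_leZ.
by apply: deg_leM (deg_le_mfall _ dX) (deg_le_mfall _ dY); rewrite addnC.
Qed.

(** Symmetric polynomials of degree at most d, in the basis
    (x + y)^i times [fall_prod j]. *)
Definition basis_span d P := exists a : nat -> nat -> F,
  P = \sum_(j < d.+1) \sum_(i < d.+1 | (i + j.*2 <= d)%N) a i j *: ((X0 + X1) ^+ i * fall_prod j).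

Lemma basis_spanD d P Q : basis_span d P -> basis_span d Q -> basis_span d (P + Q).
Proof.
case=> a -> [b ->]; exists (fun i j => a i j + b i j).
rewrite -big_split; apply: eq_bigr => j _; rewrite -big_split; apply: eq_bigr => i _.
exact/esym/scalerDl.
Qed.

Lemma basis_spanZ d c P : basis_span d P -> basis_span d (c *: P).
Proof.
case=> a ->; exists (fun i j => c * a i j).
rewrite scaler_sumr; apply: eq_bigr => j _; rewrite scaler_sumr; apply: eq_bigr => i _.
exact: scalerA.
Qed.

Lemma basis_span0 d : basis_span d 0.
Proof.
exists (fun _ _ => 0); rewrite big1 // => j _; rewrite big1 // => i _; exact: scale0r.
Qed.

Lemma basis_span_sum d I (r : seq I) (A : pred I) (f : I -> MP) :
  (forall t, A t -> basis_span d (f t)) -> basis_span d (\sum_(t <- r | A t) f t).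
Proof.
by move=> df; elim/big_rec: _ => [|t Q At]; [exact: basis_span0|apply/basis_spanD/df].
Qed.

Lemma basis_span_basis d i j : (i + j.*2 <= d)%N ->
  basis_span d ((X0 + X1) ^+ i * fall_prod j).
Proof.
move=> ijd; exists (fun i' j' => ((i' == i) && (j' == j))%:R).
have jd : (j < d.+1)%N by lia.
have id : (i < d.+1)%N by lia.
rewrite (bigD1 (Ordinal jd)) //= (bigD1 (Ordinal id)) //= !eqxx scale1r.
rewrite !big1 ?addr0 // => [j' jj|i' /andP[_ ii]].
  rewrite big1 // => i' _; rewrite [in X in (_ && X)](_ : (j' == j :> nat) = false).
    by rewrite andbF scale0r.
  by apply/negbTE.
by rewrite (_ : (i' == i :> nat) = false) ?scale0r //; apply/negbTE.
Qed.

(** Since (x - j)(y - j) = x y - j (x + y) + j^2, multiplication by x y raises j by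
    one up to terms of lower degree. *)
Lemma basis_span_mul d P : basis_span d P -> basis_span d.+2 (X0 * X1 * P).
Proof.
case=> a ->; rewrite mulr_sumr; apply: basis_span_sum => j _.
rewrite mulr_sumr; apply: basis_span_sum => i ijd; rewrite -scalerAr; apply: basis_spanZ.
have -> : X0 * X1 * ((X0 + X1) ^+ i * fall_prod j)
  = (X0 + X1) ^+ i * fall_prod j.+1
    + j%:R *: ((X0 + X1) ^+ i.+1 * fall_prod j)
    + (- (j%:R ^+ 2)) *: ((X0 + X1) ^+ i * fall_prod j).
  rewrite /fall_prod !mfallS -!mul_mpolyC mpolyCN rmorphXn /= !mpolyC_nat exprS.
  by move: (_ ^+ i) => e; ring.
apply: basis_spanD; first apply: basis_spanD; try apply: basis_spanZ; apply: basis_span_basis; lia.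
Qed.

Lemma basis_span_power i j : basis_span (i + j.*2) ((X0 + X1) ^+ i * (X0 * X1) ^+ j).
Proof.
elim: j => [|j IH].
  have := @basis_span_basis i i 0; rewrite addn0 expr0 /fall_prod !mfall0 mulr1 mulr1.
  by apply.
rewrite doubleS !addnS exprS mulrCA; exact: basis_span_mul.
Qed.

Lemma basis_spanW d d' P : (d <= d')%N -> basis_span d P -> basis_span d' P.
Proof.
move=> dd [a ->]; apply: basis_span_sum => j _; apply: basis_span_sum => i ijd.
by apply/basis_spanZ/basis_span_basis/(leq_trans ijd).
Qed.

(** The fundamental theorem writes P in the elementary polynomials x + y and x y
    with weights 1 and 2; powers of x y are then rewritten in the other basis. *)
Lemma symmetric_span d P : P \is symmetric -> deg_le d P -> basis_span d P.
Proof.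
move=> sP dP; have [t [tP wt]] := sym_fundamental sP.
have E1 : lift ord0 ord0 = ord_max :> 'I_2 by exact: val_inj.
rewrite -tP comp_mpolyE big_seq; apply: basis_span_sum => m mt; apply: basis_spanZ.
rewrite big_ord_recl big_ord1 !tnth_mktuple.
rewrite (mesym1E 2) mesymnnE !big_ord_recl !big_ord0 addr0 mulr1 E1.
have : (mnmwgt m < d.+1)%N.
  exact: leq_trans (leq_trans (mmeasure_mnm_lt _ mt) wt) dP.
rewrite /mnmwgt big_ord_recl big_ord1 E1 ltnS muln1 muln2 => wm.
exact: basis_spanW wm (basis_span_power _ _).
Qed.

Lemma eval2_fall_prod j a b : eval2 (fall_prod j) a b = falling a j * falling b j.
Proof. by rewrite /eval2 /fall_prod mevalM !meval_mfall -!/(eval2 _ _ _) eval2_X0 eval2_X1. Qed.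

Local Notation rho := (rho1 F n).

(** Expand P = sum_j q_j(x + y) [fall_prod j] with q_j of degree at most d - 2j.  At
    second coordinate j only the terms up to j survive, and by induction only the
    j-th one; the d - 2j + 1 partitions (k + j, j) of size at most d are then roots
    of q_j. *)
Lemma symmetric_vanish d P : P \is symmetric -> deg_le d P ->
  (forall mu, is_part mu -> (weight mu <= d)%N -> eval2 P (mu.1%:R + rho) mu.2%:R = 0) ->
  P = 0.
Proof.
move=> sP dP P0; have [a Pa] := symmetric_span sP dP.
have evalP x y : eval2 P x y = \sum_(j < d.+1) \sum_(i < d.+1 | (i + j.*2 <= d)%N)
     a i j * ((x + y) ^+ i * (falling x j * falling y j)).
  rewrite Pa /eval2 linear_sum; apply: eq_bigr => j _; rewrite linear_sum.
  apply: eq_bigr => i _; rewrite [LHS]mevalZ mevalM rmorphXn /= mevalD.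
  by rewrite -!/(eval2 _ x y) eval2_fall_prod eval2_X0 eval2_X1.
have rhoE (k : nat) : k%:R + rho = k%:R - theta by rewrite /rho1; ring.
suff a0 j : forall i, (i + j.*2 <= d)%N -> a i j = 0.
  rewrite Pa big1 // => j _; rewrite big1 // => i ijd; by rewrite a0 // scale0r.
elim/ltn_ind: j => j IH i ijd.
pose N := (d - j.*2).+1.
pose p := \poly_(i < N) a i j.
suff p0 : p = 0 by have := coef_poly N (a^~ j) i; rewrite -/p p0 coef0 (_ : (i < N)%N) //; rewrite /N; lia.
apply: contraTeq isT => pn0.
pose s := [seq (k + j + j)%:R - theta | k <- iota 0 N].
have sroots : all (root p) s.
  apply/allP => _ /mapP[k kN ->]; rewrite mem_iota /N in kN.
  have := P0 ((k + j)%N, j); rewrite /is_part /weight /= leq_addl => /(_ isT).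
  have kd : (k + j + j <= d)%N by lia.
  move=> /(_ kd); rewrite evalP rhoE.
  have jd : (j < d.+1)%N by lia.
  rewrite (bigD1 (Ordinal jd)) //= [X in _ + X]big1 ?addr0 => [|j' jj]; last first.
    rewrite big1 // => i' ijd'.
    have [j'j|j'j|e] := ltngtP j' j; first by rewrite IH ?mul0r.
      by rewrite falling_nat_small // !mulr0.
    by move: jj; rewrite -val_eqE /= e eqxx.
  set x := (_ - theta) + _.
  under eq_bigr => i' _ do rewrite !mulrA.
  rewrite -!mulr_suml => /eqP; rewrite mulf_eq0 mulf_eq0.
  rewrite (negPf (half_integer_falling_neq0 _ _ _ _)) falling_self (negPf (fact_neq0 _ _)) !orbF /=.
  rewrite /root (_ : (k + j + j)%:R - theta = x); last by rewrite /x natrD; ring.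
  rewrite /p horner_poly => /eqP e; apply/eqP; rewrite -{}[in RHS]e.
  rewrite (big_ord_widen d.+1 (fun i => a i j * x ^+ i)); last by rewrite /N; lia.
  by apply: eq_bigl => i'; rewrite /N; lia.
have us : uniq s.
  rewrite map_inj_uniq ?iota_uniq // => k k' /addIr /eqP.
  by rewrite eqr_nat !eqn_add2r => /eqP.
have := max_poly_roots pn0 sroots us.
by rewrite size_map size_iota ltnNge size_poly.
Qed.

End SymmetricBivariate.

Section KnopSahiValues.
Variables (F : numFieldType) (n : nat).
Local Notation theta := (n%:R + 2%:R^-1 : F).
Local Notation MP := {mpoly F[2]}.
Local Notation X0 := ('X_ord0 : MP).
Local Notation X1 := ('X_ord_max : MP).
Local Notation rho := (rho1 F n).

Lemma falling_vandermonde_widen (x y : F) m N : (m <= N)%N ->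
  falling (x + y) m
  = \sum_(i < N.+1 | (i <= m)%N) 'C(m, i)%:R * falling x i * falling y (m - i).
Proof.
move=> mN; rewrite falling_vandermonde.
by rewrite (big_ord_widen N.+1 (fun i => 'C(m, i)%:R * falling x i * falling y (m - i))).
Qed.

(** Vandermonde expansion of the falling factorial of x + theta - i turns the right
    side into the double sum. *)
Lemma ks_fun_closed m (x y : F) :
  falling theta m * ks_fun n m x y
  = \sum_(i < m.+1) gbinom theta (m - i) * gbinom theta i
      * falling (x + theta - i%:R) (m - i) * falling y i.
Proof.
rewrite /ks_fun mulr_sumr; apply: eq_bigr => i _.
have im : (i <= m)%N by rewrite -ltnS.
rewrite -[x + theta - _]addrA (@falling_vandermonde_widen x _ _ m); last by lia.
rewrite mulr_sumr mulr_sumr mulr_suml; apply: eq_big => [l|l il]; first by lia.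
have -> : (m - i - l = m - l - i)%N by lia.
have Cf : ('C(m - i, l)%:R : F) = (m - i)`!%:R / (l`!%:R * (m - l - i)`!%:R).
  rewrite (_ : (m - l - i = m - i - l)%N); last by lia.
  apply: (canRL (mulfK _)); first by rewrite mulf_neq0 ?fact_neq0.
  by rewrite -!natrM bin_fact //; lia.
have tf : falling theta (m - l) = falling theta i * falling (theta - i%:R) (m - l - i).
  by rewrite -falling_add subnKC //; lia.
rewrite /ks_coef Cf tf /gbinom (_ : (m - i - l = m - l - i)%N); last by lia.
by field; rewrite !fact_neq0 falling_half_integer_neq0.
Qed.

(** In the closed form the i-th term contains a falling factorial of b that
    vanishes for i > b, and one of a - i with m - i factors that vanishes for
    i <= b since then i <= a < m. *)
Lemma ks_fun_vanish m a b :
  (b <= a)%N -> (a + b <= m)%N -> (a, b) <> (m, 0%N) ->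
  ks_fun n m (a%:R - theta) b%:R = 0.
Proof.
move=> ba abm ne; apply: (mulfI (falling_half_integer_neq0 F n m)).
rewrite mulr0 ks_fun_closed big1 // => i _; rewrite subrK.
have im : (i <= m)%N by rewrite -ltnS.
have [ib|bi] := leqP i b; last by rewrite [falling b%:R _]falling_nat_small // mulr0.
rewrite -natrB ?(leq_trans ib ba) // [falling (a - i)%:R _]falling_nat_small ?mulr0 ?mul0r //.
rewrite ltn_sub2rE ?(leq_trans ib ba) // ltn_neqAle; apply/andP; split; last by lia.
by apply/eqP => am; apply: ne; congr (_, _); lia.
Qed.

Lemma ks_fun_one m : ks_fun n m (m%:R - theta) 0 = 1.
Proof.
apply: (mulfI (falling_half_integer_neq0 F n m)).
rewrite mulr1 ks_fun_closed big_ord_recl big1 ?addr0 => [|i _]; last first.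
  by rewrite /= fallingSl mul0r mulr0.
rewrite subn0 subrK subr0 falling_self !falling0 /gbinom falling0 fact0.
by field; rewrite fact_neq0.
Qed.

(** A multiple of P_(m+j,j): the first factor provides the zeros at partitions with
    second part smaller than j, the shifted one-row polynomial provides the others. *)
Definition ks_shift m j : MP := fall_prod F j * ks_mpoly n m (X0 - j%:R) (X1 - j%:R).

Lemma eval2_ks_shift m j x y :
  eval2 (ks_shift m j) x y
  = falling x j * falling y j * ks_fun n m (x - j%:R) (y - j%:R).
Proof.
rewrite /ks_shift /eval2 mevalM meval_ks_mpoly !mevalB !meval_nat.
by rewrite -!/(eval2 _ x y) eval2_fall_prod eval2_X0 eval2_X1.
Qed.

Lemma deg_le_ks_shift m j : deg_le (m + j.*2) (ks_shift m j).
Proof.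
have dX i : deg_le 1 ('X_i - j%:R : MP).
  by apply: deg_leB; [exact: deg_leX | exact: deg_le_nat].
apply: (@deg_leM _ j.*2 m); first by rewrite addnC.
  by apply: (@deg_leM _ j j); [rewrite addnn | apply/deg_le_mfall/deg_leX ..].
exact: deg_le_ks_mpoly.
Qed.

Lemma ks_shift_symmetric m j : ks_shift m j \is symmetric.
Proof.
apply: swap_symmetric; rewrite /ks_shift /fall_prod !msymM msym_ks_mpoly !msym_mfall.
rewrite !msymB !msym_nat msym_swap0 msym_swap1 ks_mpolyC.
by rewrite [mfall X1 _ * _]mulrC.
Qed.

Lemma ks_shift_part m j mu : is_part mu -> (weight mu <= m + j.*2)%N ->
  eval2 (ks_shift m j) (mu.1%:R + rho) mu.2%:R
  = if mu == (m + j, j)%N then j`!%:R * falling ((m + j)%:R - theta) j else 0.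
Proof.
case: mu => a b; rewrite /is_part /weight /= => ba abm.
have -> : a%:R + rho = a%:R - theta by rewrite /rho1; ring.
rewrite eval2_ks_shift.
have [jb|bj] := leqP j b; last first.
  rewrite [falling b%:R j]falling_nat_small // mulr0 mul0r.
  by case: eqP => // -[_ bj']; move: bj; rewrite bj' ltnn.
have -> : a%:R - theta - j%:R = (a - j)%:R - theta by rewrite natrB; [ring|lia].
rewrite -natrB //; case: eqP => [[-> ->]|ne].
  by rewrite subnn addnK ks_fun_one mulr1 falling_self mulrC.
rewrite ks_fun_vanish ?mulr0 //; try lia.
by case=> e1 e2; apply: ne; congr (_, _); lia.
Qed.

Definition knop_sahi (nu : nat * nat) : MP :=
  (nu.1 - nu.2)`!%:R *: ks_shift (nu.1 - nu.2) nu.2.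

Lemma knop_sahi_is_knop_sahi nu : is_part nu -> is_knop_sahi n nu (knop_sahi nu).
Proof.
case: nu => a b; rewrite /is_part /= => ba; rewrite /knop_sahi /=.
have wE : weight (a, b) = (a - b + b.*2)%N by rewrite /weight /=; lia.
have nE : (a - b + b = a)%N by rewrite subnK.
split.
- by apply: rpredZ; exact: ks_shift_symmetric.
- by apply: deg_leZ; rewrite wE; exact: deg_le_ks_shift.
- move=> mu pmu; rewrite wE => wmu ne; rewrite /eval2 mevalZ -/(eval2 _ _ _).
  rewrite ks_shift_part // nE; case: eqP => [e|_]; [by case: ne | by rewrite mulr0].
rewrite /eval2 mevalZ -/(eval2 _ _ _) (@ks_shift_part _ _ (a, b)) ?wE // nE eqxx.
by rewrite mulrA.
Qed.

(** The difference vanishes at nu as well. *)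
Lemma knop_sahi_unique nu (P Q : MP) :
  is_knop_sahi n nu P -> is_knop_sahi n nu Q -> P = Q.
Proof.
case=> sP dP P0 P1 [sQ dQ Q0 Q1]; apply/eqP; rewrite -subr_eq0; apply/eqP.
apply: (@symmetric_vanish F n (weight nu)); first exact: rpredB.
  exact: deg_leB.
move=> mu pmu wmu; rewrite /eval2 mevalB -!/(eval2 _ _ _).
by case: (eqVneq mu nu) => [->|/eqP ne]; rewrite ?P1 ?Q1 ?P0 ?Q0 ?subrr.
Qed.

(** Both sides are symmetric of degree at most m, so it suffices to compare them at
    partitions mu of size at most m.  There the left side keeps only the term with
    (m - j, j) = mu, hence both sides are 1 if mu has size m and 0 otherwise. *)
Lemma ks_binomial m (x y : F) :
  \sum_(j < m./2.+1) (j`!%:R * falling ((m - j)%:R - theta) j)^-1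
     * (falling x j * falling y j * ks_fun n (m - j.*2) (x - j%:R) (y - j%:R))
  = falling (x + y + theta) m / m`!%:R.
Proof.
pose P : MP := \sum_(j < m./2.+1) (j`!%:R * falling ((m - j)%:R - theta) j)^-1 *: ks_shift (m - j.*2) j
   - m`!%:R^-1 *: mfall (X0 + X1 + theta%:MP) m.
have jm (j : 'I_(m./2).+1) : (m - j.*2 + j.*2 = m /\ m - j.*2 + j = m - j)%N.
  by have := ltn_ord j; rewrite ltnS; lia.
have evP a b : eval2 P a b
   = \sum_(j < m./2.+1) (j`!%:R * falling ((m - j)%:R - theta) j)^-1
        * eval2 (ks_shift (m - j.*2) j) a b - m`!%:R^-1 * falling (a + b + theta) m.
  rewrite /P /eval2 mevalB linear_sum mevalZ meval_mfall !mevalD mevalC /=.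
  rewrite -!/(eval2 _ a b) eval2_X0 eval2_X1; congr (_ - _).
  by apply: eq_bigr => j _; rewrite [LHS]mevalZ.
suff P0 : P = 0.
  have := evP x y; rewrite P0 /eval2 meval0 => /esym/eqP; rewrite subr_eq0 => /eqP.
  rewrite [RHS]mulrC => <-; apply: eq_bigr => j _; congr (_ * _).
  by rewrite -/(eval2 _ x y) eval2_ks_shift.
apply: (@symmetric_vanish F n m).
- apply: rpredB.
    by apply: rpred_sum => j _; apply: rpredZ; exact: ks_shift_symmetric.
  apply/rpredZ/swap_symmetric; rewrite msym_mfall !msymD msym_swap0 msym_swap1.
  by rewrite /msym mmapC [X1 + X0]addrC.
- apply: deg_leB.
    apply: deg_le_sum => j _; apply: deg_leZ.
    by have := deg_le_ks_shift (m - j.*2) j; rewrite (jm j).1.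
  apply/deg_leZ/deg_le_mfall/deg_leD; first exact/deg_leD/deg_leX/deg_leX.
  by rewrite /deg_le mmeasureC; case: (_ != _).
move=> mu pmu wmu; rewrite evP.
have -> : mu.1%:R + rho + mu.2%:R + theta = (weight mu)%:R :> F.
  by rewrite /rho1 /weight natrD; ring.
have ev (j : 'I_(m./2).+1) : (j`!%:R * falling ((m - j)%:R - theta) j)^-1
   * eval2 (ks_shift (m - j.*2) j) (mu.1%:R + rho) mu.2%:R
   = (mu == (m - j, j : nat)%N)%:R.
  rewrite ks_shift_part ?(jm j).1 // (jm j).2; case: eqP => _; last by rewrite mulr0.
  by rewrite mulVf // mulf_neq0 ?fact_neq0 ?half_integer_falling_neq0.
under eq_bigr => j _ do rewrite ev.
case: mu pmu wmu {ev} => a b; rewrite /is_part /weight /= => ba wmu.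
have [abm|abm] := eqVneq (a + b)%N m; last first.
  rewrite falling_nat_small ?mulr0 ?subr0; last by lia.
  rewrite big1 // => j _; case: eqP => // -[e1 e2]; case/eqP: abm.
  by have := jm j; lia.
have bm : (b < m./2.+1)%N by lia.
rewrite abm falling_self mulVf ?fact_neq0 // (bigD1 (Ordinal bm)) //=.
rewrite (_ : _ == _); last by apply/eqP; congr (_, _); lia.
rewrite big1 ?addr0 ?subrr // => j jb; case: eqP => // -[_ e].
by case/eqP: jb; apply: val_inj.
Qed.

(** The value of the normalised P_(m,0) at the partition (p + q, q). *)
Definition ks_scalar m p q : F := ks_fun n m ((p + q)%:R - theta) q%:R.

Lemma ks_scalar_recursion m p q :
  \sum_(j < m./2.+1)
     (lower_coef F n (m - j.*2) j j)^-1 * lower_coef F n p q j * ks_scalar (m - j.*2)%N p (q - j)%N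
  = 'C(p + q.*2, m)%:R.
Proof.
have := ks_binomial m ((p + q)%:R - theta) q%:R.
have -> : (p + q)%:R - theta + q%:R + theta = (p + q.*2)%:R.
  by rewrite -addnn !natrD; ring.
rewrite falling_nat -bin_ffact natrM mulfK ?fact_neq0 // => <-.
apply: eq_bigr => j _; have jm : (j <= m./2)%N by rewrite -ltnS.
rewrite /lower_coef falling_self (_ : (m - j.*2 + j = m - j)%N); last by lia.
have [jq|qj] := leqP j q; last first.
  by rewrite [falling q%:R j]falling_nat_small // !(mulr0, mul0r).
rewrite /ks_scalar !natrD !natrB //; last by lia.
rewrite -[4%:R ^+ j * _ * _]mulrA [4%:R ^+ j * _]mulrC.
rewrite (_ : p%:R + (q%:R - j%:R) - theta = p%:R + q%:R - theta - j%:R); last by ring.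
have fn0 := half_integer_falling_neq0 F (m - j) n j.
rewrite natrB in fn0; last by lia.
have e0 : 4%:R ^+ j != 0 :> F by rewrite expf_neq0 // pnatr_eq0.
set K := ks_fun _ _ _ _; set A := falling (m%:R - _ - _) j in fn0 *.
set B := falling _ j; set C := falling _ j; set e := _ ^+ j in e0 *.
by field; rewrite fn0 e0 fact_neq0.
Qed.

End KnopSahiValues.

(** * The scalars of the Capelli operators *)
Section CapelliScalar.
Variables (F : numFieldType) (n : nat).
Local Notation PV := (superpoly F n).
Local Notation theta := (n%:R + 2%:R^-1 : F).
Implicit Types mu nu : nat * nat.

Definition capelli_scalar nu mu : F :=
  eval2 (ks_shift F n (nu.1 - nu.2) nu.2) (mu.1%:R - theta) mu.2%:R
  / (nu.2`!%:R * falling (nu.1%:R - theta) nu.2).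

(** The powers of 4 cancel, and both sides vanish when the second part of mu is
    smaller than that of nu. *)
Lemma capelli_scalarE nu mu : is_part nu -> is_part mu ->
  (lower_coef F n (nu.1 - nu.2) nu.2 nu.2)^-1 * lower_coef F n (mu.1 - mu.2) mu.2 nu.2
    * ks_scalar F n (nu.1 - nu.2) (mu.1 - mu.2) (mu.2 - nu.2)
  = capelli_scalar nu mu.
Proof.
case: nu mu => [a j] [b q]; rewrite /is_part /capelli_scalar /= => ja qb.
rewrite eval2_ks_shift /lower_coef falling_self !subnK //.
have [jq|qj] := leqP j q; last first.
  by rewrite [falling q%:R j]falling_nat_small // !(mulr0, mul0r).
rewrite /ks_scalar (_ : (b - q + (q - j))%N = (b - j)%N); last by lia.
rewrite !natrB //; last by lia.
rewrite (_ : b%:R - j%:R - theta = b%:R - theta - j%:R); last by ring.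
have fn0 := half_integer_falling_neq0 F a n j.
have e0 : 4%:R ^+ j != 0 :> F by rewrite expf_neq0 // pnatr_eq0.
set K := ks_fun _ _ _ _; set A := falling _ j in fn0 *.
set B := falling _ j; set C := falling _ j; set e := _ ^+ j in e0 *.
by field; rewrite fn0 e0 fact_neq0.
Qed.

Lemma capelli_acts nu mu : is_part nu -> is_part mu ->
  acts_by_scalar (@capelli_op F n nu) (V_ mu) (capelli_scalar nu mu).
Proof.
move=> pnu pmu u [h hh ->].
have [wE _ _] := weight_part pnu.
rewrite -capelli_scalarE // /capelli_op wE normal_op_proj_shift.
rewrite (iter_nabla2_iter_R2 _ _ hh).
rewrite [normal_op _ _ _]linearZ /= (normal_op_proj_scalar (@ks_scalar_recursion F n) _ _ hh).
rewrite scalerA linearZ /= scalerA mulrA -iterD.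
have [jq|qj] := leqP nu.2 mu.2; first by rewrite subnKC.
by rewrite (lower_coef_small _ _ _ qj) !(mulr0, mul0r) !scale0r.
Qed.

Lemma V_nonzero mu : Lambda_star n mu -> exists2 u : PV, V_ mu u & u <> 0.
Proof.
case=> k /and3P[pmu /eqP wk kn].
have [|h hh h0] := @harmonic_exists F n (mu.1 - mu.2).
  by move: pmu wk kn; rewrite /is_part /weight; lia.
exists (iter mu.2 (smul (R2 F n)) h); first by exists h.
by move=> e; apply: h0; apply: iter_R2_inj hh e.
Qed.

Lemma scalar_unique (D : PV -> PV) mu c c' : Lambda_star n mu ->
  acts_by_scalar D (V_ mu) c -> acts_by_scalar D (V_ mu) c' -> c = c'.
Proof.
move=> /V_nonzero[u uV u0] Dc Dc'; have := Dc' u uV.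
rewrite (Dc u uV) => /eqP; rewrite -subr_eq0 -scalerBl scaler_eq0 subr_eq0.
by case/orP=> /eqP.
Qed.

Lemma capelli_scalar_closed nu mu :
  capelli_scalar nu mu
  = falling mu.2%:R nu.2 * falling (mu.1%:R - theta) nu.2
      / (nu.2`!%:R * falling (nu.1%:R - theta) nu.2 * falling theta (nu.1 - nu.2))
    * \sum_(i < (nu.1 - nu.2).+1)
        gbinom theta (nu.1 - nu.2 - i) * gbinom theta i
        * falling (mu.1%:R - nu.2%:R - i%:R) (nu.1 - nu.2 - i)
        * falling (mu.2%:R - nu.2%:R) i.
Proof.
have E (i : nat) : mu.1%:R - nu.2%:R - i%:R
   = (mu.1%:R - theta - nu.2%:R) + theta - i%:R by ring.
under eq_bigr => i _ do rewrite E.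
rewrite -ks_fun_closed /capelli_scalar eval2_ks_shift.
have fn0 := half_integer_falling_neq0 F nu.1 n nu.2.
have tn0 := falling_half_integer_neq0 F n (nu.1 - nu.2).
set K := ks_fun _ _ _ _; set A := falling _ nu.2; set B := falling _ nu.2.
set C := falling _ nu.2 in fn0 *; set T := falling _ _ in tn0 *.
by field; rewrite fn0 tn0 fact_neq0.
Qed.

End CapelliScalar.

Theorem theorem2p6 (R : realType) (n : nat) (hn : (1 <= n)%N)
    (mu nu : nat * nat) (hmu : Lambda_star n mu) (hnu : Lambda_star n nu) :
  let half : R[i] := 2%:R^-1 in
  exists (D : superpoly R[i] n -> superpoly R[i] n)
         (P : {mpoly R[i][2]}) (c : R[i]),
    [/\ unique (@is_capelli R[i] n nu) D,
        unique (@is_knop_sahi R[i] n nu) P,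
        unique (acts_by_scalar D (V_ mu)) c,
        c = eval2 P (mu.1%:R - n%:R - half) mu.2%:R
            / ((nu.1 - nu.2)`!%:R * nu.2`!%:R
               * falling (nu.1%:R - (n%:R + half)) nu.2)
      & let a := falling mu.2%:R nu.2 * falling (mu.1%:R - (n%:R + half)) nu.2
                 / (nu.2`!%:R * falling (nu.1%:R - (n%:R + half)) nu.2
                    * falling (n%:R + half) (nu.1 - nu.2)) in
        let b := \sum_(i < (nu.1 - nu.2).+1)
                   gbinom (n%:R + half) (nu.1 - nu.2 - i)
                   * gbinom (n%:R + half) i
                   * falling (mu.1%:R - nu.2%:R - i%:R) (nu.1 - nu.2 - i)
                   * falling (mu.2%:R - nu.2%:R) i in
        c = a * b].
Proof.
move=> half.
have pnu : is_part nu by case: hnu => k /and3P[].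
have pmu : is_part mu by case: hmu => k /and3P[].
exists (capelli_op nu), (knop_sahi R[i] n nu), (capelli_scalar R[i] n nu mu); split.
- split; first exact: capelli_is_capelli.
  by move=> D' D'P; apply: boolp.funext => u; rewrite (capelli_unique hnu D'P).
- split; first exact: knop_sahi_is_knop_sahi.
  by move=> P' P'P; apply: knop_sahi_unique P'P; exact: knop_sahi_is_knop_sahi.
- split; first exact: capelli_acts.
  by move=> c' c'P; apply: scalar_unique hmu _ c'P; exact: capelli_acts.
- rewrite /capelli_scalar /eval2 mevalZ -/(eval2 _ _ _) -addrA -opprD.
  rewrite -[(nu.1 - nu.2)`!%:R * _ * _]mulrA -mulf_div divff ?fact_neq0 ?mul1r //.
exact: capelli_scalar_closed.
Qed.
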